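(* Let $(a_k)_{k\in\mathbb{N}}$ be a sequence with $a_k>0$ for all $k\in\mathbb{N}$, let $\mu=\sum_{k\in\mathbb{N}}a_k\delta_k$, and let $\check{\mathcal{E}}$ be the trace of the Bessel Dirichlet form $\mathcal{E}$ (case $n=3$) with respect to $\mu$. For every $u=(u_k)\in\ell^2(\mathbb{N},\mu)$ set $$Q[u]=\sum_{k=1}^\infty k(k+1)(u_{k+1}-u_k)^2\in[0,\infty].$$ 1. The trace form $\check{\mathcal{E}}$ is the closure in $\ell^2(\mathbb{N},\mu)$ of $Q$ restricted to $\operatorname{ran}J$. 2. Assume that $\mu(\mathbb{N})=\infty$. Then $$\check{\mathcal{D}}:=D(\check{\mathcal{E}})=\{u=(u_k)\in\ell^2(\mathbb{N},\mu):\ Q[u]<\infty\},\qquad \check{\mathcal{E}}[u]=Q[u]\ \text{ for all } u\in\check{\mathcal{D}}.$$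
   Context: $\mathbb{N}=\{1,2,\dots\}$ and $I=(0,\infty)$; $AC(I)$ denotes the (locally) absolutely continuous functions on $I$. Let $dm=2x^2\,dx$ on $I$. The Bessel Dirichlet form (case $n=3$) is the form in $L^2(I,m)$ with $$\mathcal{D}=\{u\in AC(I)\cap L^2(I,m):\ \int_0^\infty (u')^2x^2\,dx<\infty\},\qquad \mathcal{E}[u]=\int_0^\infty (u'(x))^2x^2\,dx .$$ For $\lambda>0$, $\mathcal{E}_\lambda[u]=\mathcal{E}[u]+\lambda\int_I u^2\,dm$. Trace with respect to $\mu=\sum_{k\in\mathbb{N}}a_k\delta_k$: $\ell^2(\mathbb{N},\mu)=L^2(\mathbb{N},\mu)$ is the space of real sequences with $\sum_k a_ku_k^2<\infty$. Let $D(J)=\{u\in\mathcal{D}:\sum_{k}a_ku(k)^2<\infty\}$ and $J:D(J)\to\ell^2(\mathbb{N},\mu)$, $Ju=u|_{\mathbb{N}}$. For $\lambda>0$ let $P_\lambda$ be the orthogonal projection in $(\mathcal{D},\mathcal{E}_\lambda)$ onto the $\mathcal{E}_\lambda$-orthogonal complement of $\ker J=\{u\in\mathcal{D}:u(k)=0\ \forall k\in\mathbb{N}\}$, and set $\check{\mathcal{E}}_\lambda[Ju]:=\mathcal{E}_\lambda[P_\lambda u]$ for $u\in D(J)$. Each $\check{\mathcal{E}}_\lambda$ is a closed form in $\ell^2(\mathbb{N},\mu)$ with domain $\operatorname{ran}J$, and the family is monotone increasing in $\lambda$. The trace form $\check{\mathcal{E}}$ is by definition the Mosco limit of $\check{\mathcal{E}}_\lambda$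 as $\lambda\downarrow0$. *)

(* Defs.v *)
From mathcomp Require Import all_boot all_order all_algebra.
From mathcomp Require Import all_classical all_reals all_analysis.
Import Order.TTheory GRing.Theory Num.Theory.
Import numFieldNormedType.Exports.

Set Implicit Arguments.
Unset Strict Implicit.
Unset Printing Implicit Defensive.

Local Open Scope classical_set_scope.
Local Open Scope ring_scope.

(* Functions on I = (0, oo) are represented by functions R -> R, and sequences
   indexed by {1, 2, ...} by functions nat -> R.  Values outside I, respectively
   at the index 0, are irrelevant: no definition below depends on them. *)

Section BesselForm.
Context {R : realType}.
Implicit Types (u v w : R -> R) (lam : R).

Definition AC_on (a b : R) u : Prop :=
  forall e : R, 0 < e -> exists2 d : R, 0 < d &
    forall (n : nat) (s t : nat -> R),
      (forall i, (i < n)%N -> a <= s i /\ s i <= t i /\ t i <= b) ->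
      trivIset `I_n (fun i => `]s i, t i[%classic) ->
      \sum_(i < n) (t i - s i) < d ->
      \sum_(i < n) `|u (t i) - u (s i)| < e.

Definition AC_loc u : Prop := forall a b : R, 0 < a -> a <= b -> AC_on a b u.

(* int_I u v dm with dm = 2 x^2 dx *)
Definition ip_m u v : \bar R :=
  (\int[lebesgue_measure]_(x in `]0%R, +oo[) (u x * v x * (2 * x ^+ 2))%:E)%E.

Definition L2_m u : Prop :=
  measurable_fun (`]0, +oo[%classic : set R) u /\ (ip_m u u < +oo)%E.

(* For locally absolutely continuous u, the total function derive1 u is
   the almost everywhere derivative of u. *)
Definition bessel u v : \bar R :=
  (\int[lebesgue_measure]_(x in `]0%R, +oo[)
     (derive1 u x * derive1 v x * x ^+ 2)%:E)%E.

Definition bessel_dom : set (R -> R) :=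
  [set u | [/\ AC_loc u, L2_m u & (bessel u u < +oo)%E]].

Definition bessel_lam lam u v : \bar R := (bessel u v + lam%:E * ip_m u v)%E.

Definition kerJ : set (R -> R) :=
  [set u | bessel_dom u /\ forall k : nat, (0 < k)%N -> u k%:R = 0].

Definition ortho_lam lam (M : set (R -> R)) : set (R -> R) :=
  [set w | bessel_dom w /\ forall z, M z -> bessel_lam lam w z = 0%E].

(* Orthogonal projection in (bessel_dom, bessel_lam lam) onto the subspace M;
   it is unique up to the values outside I. *)
Definition proj_lam lam (M : set (R -> R)) u : R -> R :=
  get [set w | M w /\ forall z, M z -> bessel_lam lam (u \- w) z = 0%E].

Definition P_lam lam u : R -> R := proj_lam lam (ortho_lam lam kerJ) u.

End BesselForm.

Section SequenceSpace.
Context {R : realType}.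
Variable a : nat -> R.
Implicit Types (v w : nat -> R) (q : (nat -> R) -> \bar R).

Definition mu (A : set nat) : \bar R :=
  (\sum_(1 <= k <oo) (a k)%:E * \d_k A)%E.

Definition l2_norm2 v : \bar R := (\sum_(1 <= k <oo) (a k * v k ^+ 2)%:E)%E.

Definition l2 : set (nat -> R) := [set v | (l2_norm2 v < +oo)%E].

Definition l2_ip v w : R := limn (fun n => \sum_(1 <= k < n) a k * v k * w k).

Definition strong_cvg (vn : nat -> nat -> R) v : Prop :=
  [/\ forall n, l2 (vn n), l2 v
    & l2_norm2 (vn n \- v) @[n --> \oo] --> 0%E].

Definition weak_cvg (vn : nat -> nat -> R) v : Prop :=
  [/\ forall n, l2 (vn n), l2 v
    & forall w, l2 w -> l2_ip (vn n) w @[n --> \oo] --> l2_ip v w].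

(* A form in l2 is given by its quadratic functional, with value +oo outside
   of its domain. *)
Definition form_dom q : set (nat -> R) := [set v | (q v < +oo)%E].

Definition form_restrict (A : set (nat -> R)) q v : \bar R :=
  if v \in A then q v else +oo%E.

Definition form_cvg q (vn : nat -> nat -> R) v : Prop :=
  [/\ forall n, form_dom q (vn n), strong_cvg vn v
    & forall e : R, 0 < e -> exists N : nat, forall n m : nat,
        (N <= n)%N -> (N <= m)%N -> (q (vn n \- vn m)%R < e%:E)%E].

(* The second clause contains the closability of q: the limit does not depend
   on the approximating sequence. *)
Definition is_closure q qbar : Prop :=
  form_dom qbar = [set v | exists vn, form_cvg q vn v] /\
  forall vn v, form_cvg q vn v -> q (vn n) @[n --> \oo] --> qbar v.

Definition mosco_cvg (qn : nat -> (nat -> R) -> \bar R) q : Prop :=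
  (forall vn v, weak_cvg vn v ->
     (q v <= limn_einf (fun n => qn n (vn n)))%E) /\
  (forall v, l2 v -> exists2 vn, strong_cvg vn v &
     (limn_esup (fun n => qn n (vn n)) <= q v)%E).

Definition is_mosco_limit0 (qlam : R -> (nat -> R) -> \bar R) q : Prop :=
  (forall lam : nat -> R, (forall n, 0 < lam n) -> lam @ \oo --> 0 ->
     mosco_cvg (fun n => qlam (lam n)) q) /\
  (forall v, ~ l2 v -> q v = +oo%E).

End SequenceSpace.

Section Trace.
Context {R : realType}.
Variable a : nat -> R.

Definition J (u : R -> R) : nat -> R := fun k => u k%:R.

Definition domJ : set (R -> R) := [set u | bessel_dom u /\ l2 a (J u)].

Definition ranJ : set (nat -> R) := J @` domJ.

(* check E_lam [J u] := E_lam [P_lam u] for u in D(J), and +oo outside ran J;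
   the value does not depend on the chosen preimage u of v.  The condition
   J u = v at the index 0 is no restriction, since u 0 is arbitrary. *)
Definition trace_lam (lam : R) (v : nat -> R) : \bar R :=
  if v \in ranJ then
    let w := P_lam lam (get [set u | domJ u /\ J u = v]) in bessel_lam lam w w
  else +oo%E.

Definition trace_form : (nat -> R) -> \bar R :=
  get [set q | is_mosco_limit0 a trace_lam q].

End Trace.

Definition Q {R : realType} (v : nat -> R) : \bar R :=
  (\sum_(1 <= k <oo) (k%:R * k.+1%:R * (v k.+1 - v k) ^+ 2)%:E)%E.

(* Main.v *)
Require Import Defs.
From HB Require Import structures.
From mathcomp Require Import all_boot all_order all_algebra.
From mathcomp Require Import ring lra.
From mathcomp Require Import all_classical all_reals all_analysis.
From mathcomp Require Import measurable_realfun.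
Import Order.TTheory GRing.Theory Num.Theory.
Import numFieldNormedType.Exports.

(** The substitution w = f / x turns the Bessel form into the one-dimensional
    Dirichlet form for f = x w, up to boundary terms. Among all functions with
    prescribed values at the integers, the energy is therefore least if f is linear on
    each [k, k+1], that is if w = A + B / x there and w is constant on (0, 1]; this least
    energy is exactly Q (harmonic_energy, Q_le_energy). For lam > 0 the least value of
    E_lam is attained if f is a combination of exponentials on each [k, k+1]. Such a
    function is E_lam-orthogonal to the functions vanishing on the integers
    (interpolant_orthogonal) and so computes the trace form with parameter lam. It
    follows that these trace forms lie between Q v and Q v + lam C(v) on ran J
    (trace_lam_bounds), and that ran J consists of the v in l2 for which k v(k) is square
    summable (ranJP).

    The derivative in the form is that of an arbitrary absolutely continuous function,
    hence the estimates and the integration by parts need Lebesgue's fundamental theorem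
    of calculus (AC_loc_derive, AC_loc_integral). The total variation of such a function
    is again absolutely continuous, so a nondecreasing function may be considered; its
    Lebesgue-Stieltjes measure is absolutely continuous with respect to the Lebesgue
    measure, and the function is differentiable, with the Radon-Nikodym density as
    derivative, at the Lebesgue points of the density.

    What remains concerns sequences. Traces vanish at infinity, and a sequence with
    finite Q vanishing at infinity satisfies k v(k)^2 <= Q v (cvg0_decay). This bound is
    stable under pointwise limits, so the restriction of Q to the sequences in l2 that
    vanish at infinity is lower semicontinuous even for pointwise convergence
    (Q_lower_semicontinuous). Conversely, subtracting from such a sequence its
    truncation at a small level leaves a finitely supported sequence, which belongs to
    ran J, and the truncations tend to 0 in l2 and in energy (approx_strong_cvg,
    approx_Q_cvg). Together with the two-sided bounds, these facts identify this
    restriction of Q both as the Mosco limit of the trace forms (limit_form_mosco) and as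
    the closure of Q on ran J (limit_form_closure). If the measure is infinite, square
    summability forces a sequence with finite Q to vanish at infinity
    (infinite_measure_cvg0), and the domain is described by Q and l2 alone. *)

Set Implicit Arguments.
Unset Strict Implicit.
Unset Printing Implicit Defensive.

Local Open Scope classical_set_scope.
Local Open Scope ring_scope.

(** * Families of disjoint intervals and the total variation *)

Section Families.
Context {R : realType}.
Implicit Types (a b s t e d : R) (u : R -> R) (p q : R * R).
Implicit Types (K L : seq (R * R)).

Definition apart p q := (p.2 <= q.1) || (q.2 <= p.1).

Definition subinterval a b p := [&& a <= p.1, p.1 <= p.2 & p.2 <= b].

(** The families in the definition of absolute continuity, encoded as lists so that
    they can be concatenated and an interval can be replaced by its pieces. *)
Definition interval_family a b L := all (subinterval a b) L && pairwise apart L.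

Definition total_length L := \sum_(p <- L) (p.2 - p.1).

Definition increments u L := \sum_(p <- L) `|u p.2 - u p.1|.

Lemma apartP p q : reflect (p.2 <= q.1 \/ q.2 <= p.1) (apart p q).
Proof. exact: orP. Qed.

Lemma apart_sym p q : apart p q = apart q p.
Proof. by rewrite /apart orbC. Qed.

Lemma AC_on_family a b u : AC_on a b u -> forall e, 0 < e ->
  exists2 d, 0 < d & forall L, interval_family a b L -> total_length L < d ->
    increments u L < e.
Proof.
move=> ac e e0; have [d d0 H] := ac e e0; exists d => // L /andP[aL sL].
have nthL i : (i < size L)%N -> subinterval a b (nth (a, a) L i).
  by move=> iL; exact: (all_nthP (a, a) aL).
have := H (size L) (fun i => (nth (a, a) L i).1) (fun i => (nth (a, a) L i).2).
rewrite /total_length /increments !(big_nth (a, a)) !big_mkord; apply.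
  by move=> i /nthL /and3P[].
move=> i j /= iL jL [x [/=]]; rewrite !in_itv/= => /andP[xi1 xi2] /andP[xj1 xj2].
have sep k l : (k < size L)%N -> (l < size L)%N -> (k < l)%N ->
    apart (nth (a, a) L k) (nth (a, a) L l).
  by move=> kL lL; exact: (elimT (pairwiseP (a, a)) sL).
have [ij|ji|//] := ltngtP i j.
- have /apartP[] := sep _ _ iL jL ij => h.
  + by have := lt_trans (lt_le_trans xi2 h) xj1; rewrite ltxx.
  + by have := lt_trans (lt_le_trans xj2 h) xi1; rewrite ltxx.
- have /apartP[] := sep _ _ jL iL ji => h.
  + by have := lt_trans (lt_le_trans xj2 h) xi1; rewrite ltxx.
  + by have := lt_trans (lt_le_trans xi2 h) xj1; rewrite ltxx.
Qed.

Lemma family_cons a b p L : interval_family a b (p :: L) =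
  [&& subinterval a b p, all (apart p) L & interval_family a b L].
Proof. by rewrite /interval_family /=; case: subinterval => //=; rewrite andbCA. Qed.

Lemma family_cat a b K L : interval_family a b (K ++ L) =
  [&& interval_family a b K, interval_family a b L & allrel apart K L].
Proof.
rewrite /interval_family all_cat pairwise_cat.
by case: (all _ K); case: (all _ L) => //=; rewrite ?andbF//; case: allrel; 
  rewrite ?andbF ?andbT.
Qed.

Lemma total_length_cat K L :
  total_length (K ++ L) = total_length K + total_length L.
Proof. exact: big_cat. Qed.

Lemma increments_cat u K L :
  increments u (K ++ L) = increments u K + increments u L.
Proof. exact: big_cat. Qed.

Lemma total_length_cons p L :
  total_length (p :: L) = (p.2 - p.1) + total_length L.
Proof. exact: big_cons. Qed.

Lemma increments_cons u p L :
  increments u (p :: L) = `|u p.2 - u p.1| + increments u L.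
Proof. exact: big_cons. Qed.

Lemma increments_ge0 u L : 0 <= increments u L.
Proof. exact: sumr_ge0. Qed.

Definition pieces s (l : seq R) : seq (R * R) := pairmap pair s l.

#[local] Arguments pieces : simpl never.

Lemma pieces_cons s x l : pieces s (x :: l) = (s, x) :: pieces x l.
Proof. by []. Qed.

Lemma pieces_family s t l : itv_partition s t l -> interval_family s t (pieces s l).
Proof.
elim: l s => [//|x l ih] s p.
have [/andP[sx _] _] := p.
have xl := itv_partition_cons p.
rewrite pieces_cons family_cons /subinterval/= lexx (ltW sx) (itv_partition_le xl)/=.
have fl := ih _ xl.
apply/andP; split; last first.
  move: fl; rewrite /interval_family => /andP[/allP a1 ->]; rewrite andbT; apply/allP => q /a1 /and3P[h1 h2 h3].
  by rewrite /subinterval h2 h3 (le_trans (ltW sx) h1).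
apply/allP => q; move: fl => /andP[/allP a1 _] /a1 /and3P[h1 _ _].
by rewrite /apart/= h1.
Qed.

Lemma pieces_length s t l : itv_partition s t l ->
  total_length (pieces s l) = t - s.
Proof.
elim: l s => [|x l ih] s p.
  by rewrite /total_length big_nil (itv_partition_nil p) subrr.
rewrite pieces_cons total_length_cons /= (ih _ (itv_partition_cons p)); lra.
Qed.

Lemma pieces_increments u s t l : itv_partition s t l ->
  increments u (pieces s l) = variation s t u l.
Proof.
elim: l s => [|x l ih] s p.
  by rewrite /increments big_nil variation_nil.
rewrite pieces_cons increments_cons /= (ih _ (itv_partition_cons p)).
by rewrite /variation /= big_nat_recl.
Qed.

Lemma refine_family a b s t l L : itv_partition s t l ->
  interval_family a b ((s, t) :: L) -> interval_family a b (pieces s l ++ L).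
Proof.
move=> p; rewrite family_cons family_cat => /and3P[/and3P[/= a_s st tb] sL ->].
have /andP[/allP fp1 fp2] := pieces_family p.
rewrite andTb; apply/andP; split.
  rewrite /interval_family fp2 andbT; apply/allP => q /fp1 /and3P[h1 h2 h3].
  by rewrite /subinterval h2 (le_trans a_s h1) (le_trans h3 tb).
apply/allrelP => q r /fp1 /and3P[h1 h2 h3] rL.
have /apartP[/= h|/= h] := allP sL _ rL; rewrite /apart.
  by rewrite (le_trans h3 h).
by rewrite (le_trans h h1) orbT.
Qed.

(** Increments can be replaced by total variations without spoiling the bound: the
    pieces of an arbitrary partition of one interval, together with the other
    intervals, form a family of the same total length. The list K holds the intervals
    that are already replaced, so that an induction on K treats one at a time. *)
Lemma sum_total_variation_le u a b e d :
  (forall L, interval_family a b L -> total_length L < d -> increments u L < e) ->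
  forall K L, interval_family a b (K ++ L) -> total_length (K ++ L) < d ->
  (\sum_(p <- K) total_variation p.1 p.2 u + (increments u L)%:E <= e%:E)%E.
Proof.
move=> H; elim=> [|[s t] K ih] L.
  by rewrite /= big_nil add0e lee_fin => fL lL; exact/ltW/H.
move=> fKL lKL; rewrite big_cons/=.
have key l : itv_partition s t l ->
   (\sum_(p <- K) total_variation p.1 p.2 u +
    (increments u L + variation s t u l)%:E <= e%:E)%E.
  move=> p; rewrite -(pieces_increments _ p) (addrC (increments u L)) -increments_cat.
  have perm : perm_eq (K ++ pieces s l ++ L) (pieces s l ++ K ++ L).
    by rewrite perm_catCA.
  apply: ih.
    have := @refine_family a b s t l (K ++ L) p fKL; rewrite !family_cat => /and3P[h1 /and3P[h2 h3 h4] h].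
    move: h; rewrite allrel_catr => /andP[h5 h6].
    rewrite h1 h2 h3 h6 allrel_catr h4 !andbT /=.
    rewrite allrelC; move: h5; congr (is_true _); apply: eq_allrel => x y.
    exact: apart_sym.
  rewrite /total_length (perm_big _ perm)/= -/(total_length _) total_length_cat.
  by move: lKL; rewrite (pieces_length p) /= total_length_cons.
have st : s <= t by move: fKL; rewrite /= family_cons => /andP[/and3P[]].
have fin1 : \sum_(p <- K) total_variation p.1 p.2 u \is a fin_num.
  have [l pl] : exists l, itv_partition s t l.
    have [st'|ts|->] := ltgtP s t; last by exists [::].
    - by exists [:: t]; apply: itv_partition1.
    - by move: st; rewrite leNgt ts.
  rewrite ge0_fin_numE; last first.
    rewrite big_seq; apply: sume_ge0 => p pK; apply: total_variation_ge0.
    by move: fKL => /andP[/= /andP[_]]; rewrite all_cat => /andP[/allP/(_ _ pK)/and3P[]].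
  apply: (@le_lt_trans _ _ e%:E); last exact: ltry.
  apply: le_trans (key l pl); rewrite leeDl// lee_fin addr_ge0 ?increments_ge0//.
  exact: variation_ge0.
rewrite -addeA -leeBrDr; last by rewrite fin_numD fin1.
apply: ge_ereal_sup => _ [_ [l pl <-] <-].
rewrite leeBrDr; last by rewrite fin_numD fin1.
rewrite addeCA -EFinD (addrC (variation _ _ _ _)); exact: key.
Qed.

End Families.

(** * Densities of nondecreasing absolutely continuous functions *)

Section MonotoneCase.
Context {R : realType}.
Implicit Types (a b s t e d : R) (u F : R -> R).

Definition family_AC a b u := forall e, 0 < e ->
  exists2 d, 0 < d & forall L, interval_family a b L -> total_length L < d ->
    increments u L < e.

Lemma family1 a b s t : a <= s -> s <= t -> t <= b -> interval_family a b [:: (s, t)].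
Proof. by move=> ? ? ?; rewrite /interval_family /= /subinterval/=; apply/andP; split => //; rewrite andbT; apply/and3P. Qed.

Lemma total_length1 s t : total_length [:: (s, t)] = t - s.
Proof. exact: big_seq1. Qed.

Lemma increments1 u s t : increments u [:: (s, t)] = `|u t - u s|.
Proof. exact: big_seq1. Qed.

Definition clamp a b (x : R) : R := Num.max a (Num.min x b).

Lemma clamp_bounds a b x : a <= b -> a <= clamp a b x <= b.
Proof. by move=> ab; rewrite /clamp le_max lexx /= ge_max ab ge_min lexx orbT. Qed.

Lemma clamp_id a b x : a <= x <= b -> clamp a b x = x.
Proof. by move=> /andP[ax xb]; rewrite /clamp min_l// max_r. Qed.

Lemma clamp_homo a b : {homo clamp a b : x y / x <= y}.
Proof. by move=> x y xy; rewrite /clamp le_max2// le_min2. Qed.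

Lemma clamp_dist a b x y : x <= y -> clamp a b y - clamp a b x <= y - x.
Proof.
rewrite /clamp => xy.
case: (leP x b) => ?; case: (leP y b) => ?; rewrite ?maxEle;
  repeat (case: ifPn; rewrite -?ltNge => ?); lra.
Qed.

End MonotoneCase.

Lemma open_finite_interval {R : realType} (E : set R) :
  open E -> is_interval E -> (lebesgue_measure E < +oo)%E -> E !=set0 ->
  exists s t, s < t /\ E = `]s, t[%classic.
Proof.
move=> oE /is_intervalP iE.
have noL b s x : E = [set` Interval (BSide b s) x] -> E s -> False.
  move=> Eb Es; have [e /= e0 sE] := oE _ Es.
  have := sE (s - e / 2); rewrite /= (_ : s - (s - e / 2) = e / 2); last lra.
  rewrite ger0_norm ?divr_ge0 ?ltW// => /(_ _)/wrap[]; first lra.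
  rewrite Eb /= itv_boundlr => /andP[+ _].
  by case: b {Eb}; rewrite /= bnd_simp; lra.
have noR b s x : E = [set` Interval x (BSide b s)] -> E s -> False.
  move=> Eb Es; have [e /= e0 sE] := oE _ Es.
  have := sE (s + e / 2); rewrite /= (_ : s - (s + e / 2) = - (e / 2)); last lra.
  rewrite normrN ger0_norm ?divr_ge0 ?ltW// => /(_ _)/wrap[]; first lra.
  rewrite Eb /= itv_boundlr => /andP[_ +].
  by case: b {Eb}; rewrite /= bnd_simp; lra.
rewrite iE lebesgue_measure_itv.
case: (Rhull E) iE => -[b1 s|[]] [b2 t|[]] iE; rewrite -iE /= ?ltry ?ltNyr //;
  try (by move=> _ [x]; rewrite iE /= itv_boundlr => /andP[]).
have [st _ _|ts _ [x Ex]] := ltP s t.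
  exists s, t; split => //; case: b1 iE => iE.
    case: (noL _ _ _ iE); rewrite iE /= itv_boundlr.
    by case: b2 {iE}; rewrite /= !bnd_simp ?lexx ?ltW.
  case: b2 iE => // iE; case: (noR _ _ _ iE); rewrite iE /= itv_boundlr.
  by rewrite /= !bnd_simp st.
move: (Ex); rewrite iE /= itv_boundlr => /andP[sx xt].
have xs : x = s.
  move: sx xt; case: b1 {iE} => /=; case: b2; rewrite !bnd_simp => ? ?; lra.
case: b1 iE sx => iE sx; first by case: (noL _ _ _ iE); rewrite -xs.
by move: sx; rewrite bnd_simp xs ltxx.
Qed.

Lemma stieltjes_itvoc {R : realType} (f : cumulative R R) (s t : R) : s <= t ->
  lebesgue_stieltjes_measure f `]s, t]%classic = (f t - f s)%:E.
Proof.
move=> st; rewrite /lebesgue_stieltjes_measure /measure_extension.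
rewrite measurable_mu_extE/=; last exact: is_ocitv.
by rewrite wlength_itv_bnd// EFinB.
Qed.

Section StieltjesDensity.
Context {R : realType}.
Variables (a b : R) (F : R -> R).
Hypotheses (ab : a <= b) (acF : family_AC a b F)
  (ndF : {in `[a, b] &, nondecreasing F}).

(** The extension of F by constants, which makes the Lebesgue-Stieltjes measure finite. *)
Let Phi (x : R) : R := F (clamp a b x).

Let clampab x : clamp a b x \in `[a, b].
Proof. by rewrite in_itv /= clamp_bounds. Qed.

Let Phi_nd : nondecreasing Phi.
Proof. by move=> x y xy; apply: ndF; rewrite ?clampab ?clamp_homo. Qed.

(** Clamping keeps intervals disjoint and does not lengthen them, so the modulus of
    absolute continuity of F on [a, b] serves for Phi on the whole line. *)
Let Phi_family_lt e : 0 < e -> exists2 d, 0 < d & forall L,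
  pairwise apart L -> all (fun p => p.1 <= p.2) L -> total_length L < d ->
  \sum_(p <- L) (Phi p.2 - Phi p.1) < e.
Proof.
move=> e0; have [d d0 H] := acF e0; exists d => // L sL lL tL.
pose c := clamp a b.
have fam : interval_family a b [seq (c p.1, c p.2) | p <- L].
  apply/andP; split.
    rewrite all_map; apply/allP => p /(allP lL) p12 /=; apply/and3P; split => /=.
    - by have /andP[] := clamp_bounds p.1 ab.
    - exact: clamp_homo.
    - by have /andP[] := clamp_bounds p.2 ab.
  rewrite pairwise_map; apply: sub_pairwise sL => p q /apartP[h|h];
    apply/apartP => /=; [left|right]; exact: clamp_homo.
have := H _ fam; rewrite /total_length /increments !big_map /=.
have -> : \sum_(p <- L) (Phi p.2 - Phi p.1) =
          \sum_(p <- L) `|F (c p.2) - F (c p.1)|.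
  apply: eq_big_seq => p /(allP lL) p12.
  by rewrite ger0_norm// subr_ge0; exact: Phi_nd.
apply; apply: le_lt_trans tL; rewrite /total_length big_seq [leRHS]big_seq.
by apply: ler_sum => p /(allP lL) p12; exact: clamp_dist.
Qed.

Let Phi_cont : continuous Phi.
Proof.
move=> x; apply/cvgrPdist_lt => e e0.
have [d d0 H] := Phi_family_lt e0.
near=> y.
have xyd : `|x - y| < d by near: y; exact: cvgr_dist_lt.
have [xy|yx] := leP x y.
- have := H [:: (x, y)]; rewrite /= xy /total_length !big_seq1/= => /(_ erefl erefl).
  rewrite distrC (ger0_norm (_ : 0 <= Phi y - Phi x)) ?subr_ge0 ?Phi_nd//; apply.
  by move: xyd; rewrite distrC ger0_norm// subr_ge0.
- have := H [:: (y, x)]; rewrite /= (ltW yx) /total_length !big_seq1/= => /(_ erefl erefl).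
  rewrite (ger0_norm (_ : 0 <= Phi x - Phi y)) ?subr_ge0 ?Phi_nd ?ltW//; apply.
  by move: xyd; rewrite ger0_norm// subr_ge0 ltW.
Unshelve. all: by end_near. Qed.

Let PhiC : cumulative R R :=
  HB.pack Phi (isCumulative.Build R _ R Phi Phi_nd (right_continuousW Phi_cont)).

Let nu : {measure set (measurableTypeR R) -> \bar R} :=
  lebesgue_stieltjes_measure PhiC.

Let nu_itvoc s t : s <= t -> nu `]s, t]%classic = (Phi t - Phi s)%:E.
Proof.
exact: (stieltjes_itvoc PhiC).
Qed.

Let nu_finite : fin_num_fun nu.
Proof.
apply: lty_fin_num_fun.
pose I n : set R := `]- (n%:R), n%:R]%classic.
have mI n : measurable (I n) by exact: measurable_itv.
have IT : \bigcup_n I n = setT := bigcup_itvT false false.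
have cI : (nu \o I) n @[n --> \oo] --> nu (\bigcup_n I n).
  apply: nondecreasing_cvg_mu => //.
    by apply: bigcup_measurable => n _; exact: mI.
  by move=> m n mn; apply/subsetPset/subset_itv; rewrite leBSide/= ?lerN2 ler_nat.
suff: (limn (nu \o I) < +oo)%E by rewrite (cvg_lim _ cI)// IT.
apply: (@le_lt_trans _ _ (F b - F a)%:E); last exact: ltry.
apply: lime_le; first by apply/cvg_ex; eexists; exact: cI.
apply: nearW => n /=; rewrite nu_itvoc; last by rewrite ge0_cp.
rewrite lee_fin; apply: lerB; apply: ndF; rewrite ?clampab// ?in_itv/= ?lexx ?ab//.
  by have /andP[] := clamp_bounds n%:R ab.
by have /andP[] := clamp_bounds (- n%:R) ab.
Qed.

Let nuF : {finite_measure set (measurableTypeR R) -> \bar R} :=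
  HB.pack (Measure.sort nu)
    (Measure_isFinite.Build _ _ _ nu nu_finite).

(** A null set is covered by an open set of small measure; on the intervals
    composing it the absolute continuity of F bounds the Stieltjes measure. *)
Let nu_dominated : nuF `<< (@lebesgue_measure R).
Proof.
apply/null_content_dominatesP => A mA A0.
apply/eqP; rewrite eq_le measure_ge0 andbT; apply/lee_addgt0Pr => e e0.
rewrite add0e.
have [d d0 H] := Phi_family_lt e0.
have A0' : (lebesgue_measure A < +oo)%E by rewrite A0.
have [U [oU AU UA]] := lebesgue_regularity_outer mA A0' d0.
have mU : measurable U by exact: open_measurable.
have muU : (lebesgue_measure U < d%:E)%E.
  apply: le_lt_trans UA; rewrite -[U in leLHS](setDUK AU).
  apply: le_trans (measureU2 _ _ _) _ => //; first exact: measurableD.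
  by rewrite A0 add0e.
apply: (@le_trans _ _ (nu U)); first by apply: le_measure; rewrite ?inE.
pose I := open_disjoint_itv oU.
have UI : U = \bigcup_i I i := open_disjoint_itv_bigcup oU.
have IU i : I i `<=` U by rewrite UI => x Ix; exists i.
have mI i : measurable (I i) by apply: open_measurable; exact: open_disjoint_itv_open.
have tI : trivIset setT I := @open_disjoint_itv_trivIset R U oU.
rewrite [in leLHS]UI measure_bigcup//=; last by move=> i _; exact: mI.
apply: lime_le; first by apply: is_cvg_nneseries => *; exact: measure_ge0.
apply: nearW => n.
have /choice[p Ip] i : exists p : R * R, p.1 <= p.2 /\ I i = `]p.1, p.2[%classic.
  have [->|/set0P I0] := eqVneq (I i) set0.
    by exists (0, 0); split => //=; rewrite set_itvoo0.
  have [||||s [t [st ->]]] := @open_finite_interval _ (I i).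
  - exact: open_disjoint_itv_open.
  - exact: open_disjoint_itv_is_interval.
  - apply: (@le_lt_trans _ _ (lebesgue_measure U)); last exact: lt_trans muU (ltry _).
    by apply: le_measure; rewrite ?inE; [exact: mI|exact: mU|exact: IU].
  - by [].
  - by exists (s, t); rewrite ltW.
have leI : (\sum_(0 <= i < n) nu (I i) <=
    \sum_(0 <= i < n) (Phi (p i).2 - Phi (p i).1)%:E)%E.
  apply: lee_sum => i _; have [p12 ->] := Ip i; rewrite -nu_itvoc//.
  by apply: le_measure; rewrite ?inE//; exact: subset_itv_oo_oc.
rewrite (eq_bigl (fun=> true)); last by move=> i; rewrite in_setT.
apply: (le_trans leI); rewrite sumEFin lee_fin ltW//.
(* Empty components are encoded by (0, 0), which may lie inside another component;
   they contribute nothing to the sums and are dropped. *)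
pose L := [seq p i | i <- index_iota 0 n & (p i).1 < (p i).2].
have bigL (f : R * R -> R) : (forall i, (p i).1 = (p i).2 -> f (p i) = 0) ->
    \sum_(0 <= i < n) f (p i) = \sum_(q <- L) f q.
  move=> f0; rewrite /L big_map big_filter [RHS]big_mkcond/=; apply: eq_bigr => i _.
  by have [//|pi] := ltP; apply: f0; apply/eqP; rewrite eq_le pi andbT (Ip i).1.
rewrite (bigL (fun q => Phi q.2 - Phi q.1)); last by move=> i ->; rewrite subrr.
apply: H.
- rewrite pairwise_map.
  apply: (@sub_in_pairwise _ (fun i => (p i).1 < (p i).2) (fun i j => i != j)).
  + move=> i j pi pj ij; apply/negPn/negP; rewrite negb_or -!ltNge => /andP[h1 h2].
    pose x := (Num.max (p i).1 (p j).1 + Num.min (p i).2 (p j).2) / 2.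
    have lr : Num.max (p i).1 (p j).1 < Num.min (p i).2 (p j).2.
      by rewrite gt_max !lt_min; apply/andP; split; apply/andP; split.
    have xl : Num.max (p i).1 (p j).1 < x by rewrite /x; lra.
    have xr : x < Num.min (p i).2 (p j).2 by rewrite /x; lra.
    move: xl xr; rewrite gt_max lt_min => /andP[xi1 xj1] /andP[xi2 xj2].
    move/eqP : ij; apply; apply: tI => //; exists x.
    by rewrite (Ip i).2 (Ip j).2 /= !in_itv/= xi1 xi2 xj1.
  + exact: filter_all.
  + by rewrite -uniq_pairwise filter_uniq// iota_uniq.
- by rewrite all_map; apply: sub_all (filter_all _ _) => i /ltW.
- rewrite -lte_fin; apply: le_lt_trans muU.
  rewrite /total_length -(bigL (fun q => q.2 - q.1)); last first.
    by move=> i ->; rewrite subrr.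
  rewrite [in leRHS]UI measure_bigcup//=; last by move=> i _; exact: mI.
  apply: le_trans (nneseries_lim_ge n _); last by move=> *; exact: measure_ge0.
  rewrite -sumEFin; under [leRHS]eq_bigl => i do rewrite in_setT.
  apply: lee_sum => i _; have [p12 ->] := Ip i.
  rewrite lebesgue_measure_itv/= lte_fin; case: ltP => // p21.
  by rewrite lee_fin subr_le0.
Qed.

(** The Radon-Nikodym density of the Stieltjes measure of F. *)
Lemma nondecreasing_AC_density : exists g : R -> R,
  [/\ (lebesgue_measure : {measure set _ -> \bar R}).-integrable setT (EFin \o g)
     & forall x, a <= x <= b ->
       (F x - F a)%:E = (\int[lebesgue_measure]_(t in `]a, x]) (g t)%:E)%E].
Proof.
have [f [f0 ffin fi fE]] := radon_nikodym_sigma_finite nu_dominated.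
have fK x : (fine (f x))%:E = f x by rewrite fineK.
exists (fine \o f); split.
  by apply: eq_integrable fi => // x _; rewrite /= fK.
move=> x /andP[ax xb].
under eq_integral do rewrite /= fK.
rewrite -fE//=; have -> : nu `]a, x]%classic = (Phi x - Phi a)%:E by exact: nu_itvoc.
by rewrite /Phi !clamp_id ?ax ?lexx ?ab.
Qed.

End StieltjesDensity.

(** * Absolutely continuous functions as indefinite integrals *)

Section TotalVariation.
Context {R : realType}.
Implicit Types (a b s t e d : R) (u v : R -> R).

Lemma family_AC_sub a b u v : family_AC a b u -> family_AC a b v ->
  family_AC a b (u \- v).
Proof.
move=> acu acv e e0.
have e20 : 0 < e / 2 by rewrite divr_gt0.
have [d1 d10 H1] := acu _ e20; have [d2 d20 H2] := acv _ e20.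
exists (Num.min d1 d2); first by rewrite lt_min d10.
move=> L fL; rewrite lt_min => /andP[l1 l2].
apply: (@le_lt_trans _ _ (increments u L + increments v L)); last first.
  by have := H1 _ fL l1; have := H2 _ fL l2; lra.
rewrite /increments -big_split/=; apply: ler_sum => p _.
have -> : (u \- v) p.2 - (u \- v) p.1 = (u p.2 - u p.1) - (v p.2 - v p.1).
  by rewrite /=; ring.
exact: ler_normB.
Qed.

Lemma total_variation_short a b u : family_AC a b u ->
  exists2 d, 0 < d & forall s t, a <= s -> s <= t -> t <= b -> t - s < d ->
    total_variation s t u \is a fin_num.
Proof.
move=> ac; have [d d0 H] := ac 1 ltr01; exists d => // s t as_ st tb std.
rewrite ge0_fin_numE ?total_variation_ge0//.
apply: (@le_lt_trans _ _ 1%:E); last exact: ltry.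
have := @sum_total_variation_le _ u a b 1 d H [:: (s, t)] [::].
rewrite cats0 total_length1 => /(_ (family1 as_ st tb) std).
by rewrite big_seq1 /= /increments big_nil adde0.
Qed.

(** On intervals shorter than the modulus for e = 1 the variation is at most 1, and
    finitely many steps of length d / 2 reach t. *)
Lemma total_variation_fin a b u t : family_AC a b u -> a <= t -> t <= b ->
  total_variation a t u \is a fin_num.
Proof.
move=> ac; have [d d0 H] := total_variation_short ac.
suff K k x : a <= x -> x <= b -> x - a < k%:R * (d / 2) ->
    total_variation a x u \is a fin_num.
  move=> at_ tb; apply: (K (Num.bound ((t - a) / (d / 2)))) => //.
  rewrite -ltr_pdivrMr ?divr_gt0//; apply: le_lt_trans (archi_boundP _) => //.
  by rewrite divr_ge0 ?subr_ge0// ltW// divr_gt0.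
elim: k x => [|k ih] x ax xb; first by rewrite mul0r; lra.
rewrite -natr1 mulrDl mul1r => xk.
pose y := Num.max a (x - d / 2).
have ay : a <= y by rewrite le_max lexx.
have yx : y <= x by rewrite ge_max ax/=; lra.
rewrite (total_variationD _ ay yx) fin_numD; apply/andP; split.
  have [xa|xa] := leP (x - d / 2) a.
    rewrite /y max_l//; rewrite /total_variation.
    by have := total_variationxx a u; rewrite /total_variation => ->.
  apply: ih => //; first by rewrite (le_trans yx).
  by rewrite /y max_r ?ltW//; lra.
apply: H => //; suff : x - d / 2 <= y by lra.
by rewrite le_max lexx orbT.
Qed.

(** V is the total variation: sum_total_variation_le turns the modulus of u for e / 2
    into one of V for e. *)
Lemma AC_variation a b u : family_AC a b u -> exists V : R -> R,
  [/\ family_AC a b V &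
      {in `[a, b] &, forall s t, s <= t -> `|u t - u s| <= V t - V s}].
Proof.
move=> ac; pose V x := fine (total_variation a x u).
have VB s t : a <= s -> s <= t -> t <= b ->
    total_variation s t u = (V t - V s)%:E.
  move=> as_ st tb; have at_ := le_trans as_ st; have sb := le_trans st tb.
  rewrite EFinB !fineK ?(total_variation_fin ac)//.
  by rewrite (total_variationD _ as_ st) addeAC subee ?add0e// (total_variation_fin ac).
exists V; split; last first.
  move=> s t; rewrite !in_itv/= => /andP[as_ sb] /andP[at_ tb] st.
  by rewrite -lee_fin -VB//; exact: total_variation_ge.
move=> e e0; have e20 : 0 < e / 2 by rewrite divr_gt0.
have [d d0 H] := ac _ e20; exists d => // L fL lL.
have := @sum_total_variation_le _ u a b _ d H L [::].
rewrite cats0 => /(_ fL lL); rewrite /increments big_nil adde0 big_seq.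
rewrite (eq_bigr (fun p => `|V p.2 - V p.1|%:E)); last first.
  move=> p pL; have /andP[/allP/(_ _ pL)/and3P[h1 h2 h3] _] := fL.
  rewrite VB// ger0_norm// -lee_fin -VB//; exact: total_variation_ge0.
rewrite -big_seq sumEFin lee_fin => /le_lt_trans; apply; lra.
Qed.

(** Both V and V - u are nondecreasing and absolutely continuous, where V is the
    total variation. *)
Lemma AC_density a b u : a <= b -> AC_on a b u -> exists g : R -> R,
  (lebesgue_measure : {measure set _ -> \bar R}).-integrable setT (EFin \o g) /\
  forall x, a <= x <= b ->
    (u x - u a)%:E = (\int[lebesgue_measure]_(t in `]a, x]) (g t)%:E)%E.
Proof.
move=> ab /AC_on_family ac.
have [V [acV Vu]] := AC_variation ac.
have Vnd : {in `[a, b] &, nondecreasing V}.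
  by move=> s t sab tab st; have := Vu _ _ sab tab st; have := normr_ge0 (u t - u s); lra.
have Wnd : {in `[a, b] &, nondecreasing (V \- u)}.
  move=> s t sab tab st /=; have := Vu _ _ sab tab st.
  by have := ler_norm (u t - u s); lra.
have [g [gi gE]] := nondecreasing_AC_density ab acV Vnd.
have [h [hi hE]] := nondecreasing_AC_density ab (family_AC_sub acV ac) Wnd.
exists (g \- h); split.
  rewrite (_ : EFin \o _ = (EFin \o g) \- (EFin \o h))%E; last first.
    by apply/funext => x /=; rewrite EFinB.
  exact: integrableB.
move=> x xab; under eq_integral do rewrite /= EFinB.
rewrite integralB//; last 2 first.
- exact: integrableS gi.
- exact: integrableS hi.
rewrite -gE// -hE// -EFinB; congr EFin => /=; ring.
Qed.

End TotalVariation.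

(** * The fundamental theorem of calculus on the half-line *)

Section DerivativeAC.
Context {R : realType}.
Implicit Types (a b s t e d x : R) (u v : R -> R).

Notation mu := (@lebesgue_measure R).
Notation I0 := (`]0, +oo[%classic : set R).

Lemma AC_loc_continuous u : AC_loc u -> {in I0, continuous u}.
Proof.
move=> ac x; rewrite inE/= in_itv/= andbT => x0.
have ax : 0 < x / 2 by rewrite divr_gt0.
have /AC_on_family acx : AC_on (x / 2) (2 * x) u by apply: ac => //; lra.
apply/cvgrPdist_lt => e e0; have [d d0 H] := acx _ e0.
near=> y.
have xyd : `|x - y| < d by near: y; exact: cvgr_dist_lt.
have xyx : `|x - y| < x / 2 by near: y; exact: cvgr_dist_lt.
have [xy|yx] := leP x y.
- move: xyx xyd; rewrite distrC ger0_norm ?subr_ge0// => xyx xyd.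
  have fxy : interval_family (x / 2) (2 * x) [:: (x, y)] by apply: family1; lra.
  by have := H _ fxy; rewrite total_length1 increments1 distrC; exact.
- move: xyx xyd; rewrite ger0_norm ?subr_ge0 ?ltW// => xyx xyd.
  have fyx : interval_family (x / 2) (2 * x) [:: (y, x)] by apply: family1; lra.
  by have := H _ fyx; rewrite total_length1 increments1; exact.
Unshelve. all: by end_near. Qed.

(** Equal to the derivative wherever there is one and, for continuous u, Borel as the
    upper limit of a sequence of continuous functions; it stands in for derive1, whose values at the
    points of nondifferentiability are those of a choice. *)
Definition upper_derivative u x : R :=
  fine (limn_esup (fun n => (n.+1%:R * (u (x + n.+1%:R^-1) - u x))%:E)).

Lemma measurable_upper_derivative u : {in I0, continuous u} ->
  measurable_fun I0 (upper_derivative u).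
Proof.
move=> cu; apply: measurableT_comp; first exact: fine_measurable.
apply: measurable_fun_limn_esup => n; apply/measurable_EFinP.
apply: measurable_funM; first exact: measurable_cst.
apply: measurable_funB; last exact: open_continuous_measurable_fun.
apply: open_continuous_measurable_fun; first exact: interval_open.
move=> x; rewrite inE/= in_itv/= andbT => x0.
apply: continuous_comp; first exact: (cvgD cvg_id (cvg_cst _)).
by apply: cu; rewrite inE/= in_itv/= andbT addr_gt0.
Qed.

Lemma upper_derivativeE u x : derivable u x 1 -> upper_derivative u x = derive1 u x.
Proof.
move=> du; rewrite /upper_derivative.
suff h : (n.+1%:R * (u (x + n.+1%:R^-1) - u x))%:E @[n --> \oo] --> (derive1 u x)%:E.
  by rewrite (cvg_limn_einf_sup h).2.
apply/cvg_EFin; first exact: nearW.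
rewrite derive1E; have /cvg_ex[l ul] := du.
have -> : 'D_1 u x = l by apply/cvg_lim.
have hr : h^-1 *: (u (h *: 1 + x) - u x) @[h --> 0^'+] --> l.
  exact: cvg_dnbhs_at_right.
have /cvg_at_rightP/(_ (fun n => n.+1%:R^-1)) := hr.
have h0 : (forall n, n.+1%:R^-1 > 0 :> R) /\
    (n.+1%:R^-1 @[n --> \oo] --> (0 : R)).
  by split => [n|]; [rewrite invr_gt0|exact: cvg_harmonic].
move=> /(_ h0); apply: cvg_trans; apply: near_eq_cvg; apply: nearW => n /=.
by rewrite invrK /GRing.scale /= mulr1 (addrC x).
Qed.

Lemma upper_derivative_is_derive u x l :
  is_derive x 1 u l -> upper_derivative u x = l.
Proof. by move=> [du <-]; rewrite upper_derivativeE// derive1E. Qed.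

(** At the Lebesgue points of the density g the derivative of u is g. *)
Lemma AC_density_derive a b u : a <= b -> AC_on a b u -> exists g : R -> R,
  [/\ mu.-integrable setT (EFin \o g),
    (forall s t, a <= s -> s <= t -> t <= b ->
      (u t - u s)%:E = (\int[mu]_(x in `]s, t]) (g x)%:E)%E) &
    {ae mu, forall x, a < x < b -> is_derive x 1 u (g x)}].
Proof.
move=> ab /(AC_density ab)[g [gi gE]]; exists g.
have giS (A : set R) : measurable A -> mu.-integrable A (EFin \o g).
  by move=> mA; exact: integrableS gi.
have gfin (A : set R) : measurable A ->
    (\int[mu]_(x in A) (g x)%:E)%E \is a fin_num.
  by move=> mA; apply: integrable_fin_num => //; exact: giS.
split => //.
- move=> s t as_ st tb.
  have at_ := le_trans as_ st; have sb := le_trans st tb.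
  have : (u t - u a)%:E = ((u s - u a)%:E +
      \int[mu]_(x in `]s, t]) (g x)%:E)%E.
    rewrite !gE ?as_ ?at_//.
    rewrite (@itv_bndbnd_setU _ _ (BRight a) (BRight s) (BRight t)) ?bnd_simp//.
    rewrite integral_setU//=.
    + exact/measurable_funTS/measurable_int/gi.
    + by apply/disj_setPS => x /= []; rewrite !in_itv/= => /andP[_ xs] /andP[sx _];
        rewrite ltNge xs in sx.
  rewrite -(fineK (gfin `]s, t]%classic _))// -EFinD => -[] h.
  by congr EFin; lra.
have := @FTC1 _ g (BRight a) (fun y => giS _ (measurable_itv _))
  (open_integrable_locally openT gi).
apply: filterS; first exact: (ae_filter_ringOfSetsType mu).
move=> x H /andP[ax xb].
have ax' : (BRight a < BRight x)%O by rewrite bnd_simp.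
have := H ax'; set F := (fun y => _) => -[dF dFE].
have dF' : is_derive x 1 F (g x) by rewrite -dFE derive1E; exact: DeriveDef.
have -> : g x = 0 + g x by rewrite add0r.
have : is_derive x 1 (cst (u a) \+ F) (0 + g x) by exact: is_deriveD.
apply: near_eq_is_derive; near=> y.
have ay : a < y by near: y; exact: lt_nbhsr.
have yb : y < b by near: y; exact: lt_nbhsl.
by rewrite /F /= /Rintegral -gE ?ltW//= addrC subrK.
Unshelve. all: by end_near. Qed.

(** The intervals (1/(n+1), n+1) exhaust the half-line, and upper_derivative is a
    derivative on each of them outside a null set. *)
Lemma AC_loc_derive u : AC_loc u ->
  {ae mu, forall x, 0 < x -> is_derive x 1 u (upper_derivative u x)}.
Proof.
move=> ac.
have : {ae mu, forall x, forall n, n.+1%:R^-1 < x < n.+1%:R ->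
    is_derive x 1 u (upper_derivative u x)}.
  apply: ae_foralln => n.
  have n1 : n.+1%:R^-1 <= n.+1%:R :> R.
    by rewrite (@le_trans _ _ 1)// ?invf_le1// ler1n.
  have [//|g [_ _]] := @AC_density_derive n.+1%:R^-1 n.+1%:R u n1; first exact: ac.
  apply: filterS; first exact: (ae_filter_ringOfSetsType mu).
  by move=> x gx /gx dx; rewrite (upper_derivative_is_derive dx).
apply: filterS; first exact: (ae_filter_ringOfSetsType mu).
move=> x H x0.
pose n := maxn (Num.bound x) (Num.bound x^-1).
apply: (H n); apply/andP; split.
- rewrite invf_plt ?posrE//; apply: lt_le_trans (archi_boundP _) _.
    by rewrite invr_ge0 ltW.
  by rewrite ler_nat leqW// leq_maxr.
- apply: lt_le_trans (archi_boundP _) _; first exact: ltW.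
  by rewrite ler_nat leqW// leq_maxl.
Qed.

(** Lebesgue's fundamental theorem of calculus: on each compact interval the density of
    u is almost everywhere upper_derivative u. *)
Lemma AC_loc_integral u s t : AC_loc u -> 0 < s -> s <= t ->
  mu.-integrable `]s, t] (EFin \o upper_derivative u) /\
  (u t - u s)%:E = (\int[mu]_(x in `]s, t]) (upper_derivative u x)%:E)%E.
Proof.
move=> ac s0 st; pose D : set R := `]s, t]%classic.
have mD : measurable D by exact: measurable_itv.
have st1 : s <= t + 1 by lra.
have [|g [gi gE gae]] := AC_density_derive st1 (_ : AC_on s (t + 1) u).
  exact: ac.
have mG : measurable_fun D (EFin \o upper_derivative u).
  apply/measurable_EFinP; apply: measurable_funS (measurable_upper_derivative _).
  - exact: measurable_itv.
  - by move=> x; rewrite /D /= !in_itv/= andbT => /andP[sx _]; exact: lt_trans sx.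
  - exact: AC_loc_continuous.
have mg : measurable_fun D (EFin \o g) 
  by apply: measurable_funTS; case/integrableP : gi.
have aeE : ae_eq mu D (EFin \o g) (EFin \o upper_derivative u).
  apply: filterS gae; first exact: (ae_filter_ringOfSetsType mu).
  move=> x gx; rewrite /D /= in_itv/= => /andP[sx xt].
  by rewrite (upper_derivative_is_derive (gx _))// sx/=; lra.
split; last by rewrite gE//; [exact: ae_eq_integral|lra].
apply/integrableP; split => //.
have /integrableP[_] : mu.-integrable D (EFin \o g) by exact: integrableS gi.
apply: le_lt_trans; rewrite le_eqVlt; apply/orP; left; apply/eqP/esym.
apply: ge0_ae_eq_integral => //; [exact: measurableT_comp|
  exact: measurableT_comp|exact: ae_eq_abse].
Qed.

End DerivativeAC.

(** * The Bessel form as an inner product *)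

Section AeIntegral.
Context d (T : measurableType d) (R : realType) (mu : {measure set T -> \bar R}).
Local Open Scope ereal_scope.
Import HBNNSimple.

Let ge0_integral_le_off (N : set T) (f g : T -> \bar R) :
  measurable N -> mu N = 0 -> (forall x, 0 <= f x) -> (forall x, 0 <= g x) ->
  (forall x, ~ N x -> f x = g x) -> \int[mu]_x f x <= \int[mu]_x g x.
Proof.
move=> mN N0 f0 g0 fg; rewrite !ge0_integralTE//.
apply: ge_ereal_sup => _ [h /= hf <-].
pose h' := proj_nnsfun h (measurableC mN).
apply: le_ereal_sup_tmp; exists (sintegral mu h').
  exists h' => //= x; rewrite mindicE.
  have [|] := boolP (x \in ~` N); last by rewrite mulr0.
  by rewrite inE mulr1 => Nx; rewrite -fg.
rewrite -!integralT_nnsfun le_eqVlt; apply/orP; left; apply/eqP.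
apply: ge0_ae_eq_integral => //.
- exact/measurable_EFinP.
- exact/measurable_EFinP.
- by move=> x _; rewrite lee_fin fun_ge0.
- by move=> x _; rewrite lee_fin fun_ge0.
exists N; split => // x /= H; apply: contrapT => Nx; apply: H => _.
by rewrite mindicE mem_set//= mulr1.
Qed.

Let ge0_integral_off (N : set T) (f g : T -> \bar R) :
  measurable N -> mu N = 0 -> (forall x, 0 <= f x) -> (forall x, 0 <= g x) ->
  (forall x, ~ N x -> f x = g x) -> \int[mu]_x f x = \int[mu]_x g x.
Proof.
move=> mN N0 f0 g0 fg; apply/eqP; rewrite eq_le (ge0_integral_le_off mN N0)//=.
by rewrite (ge0_integral_le_off mN N0)// => x /fg.
Qed.

(** The integral is a supremum over simple functions, which may be cut off on a null
    set. As f and g are arbitrary functions, the lemma applies to integrands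
    containing derive1. *)
Lemma ae_integral_ext (D : set T) (f g : T -> \bar R) :
  {ae mu, forall x, D x -> f x = g x} ->
  \int[mu]_(x in D) f x = \int[mu]_(x in D) g x.
Proof.
move=> [N [mN N0 sN]].
have fgN x : ~ N x -> (f \_ D) x = (g \_ D) x.
  move=> Nx; rewrite !patchE; case: ifPn => //; rewrite inE => Dx.
  by apply: contrapT => fg; apply: Nx; apply: sN => /(_ Dx).
rewrite integral_mkcond [RHS]integral_mkcond integralE [RHS]integralE.
by congr (_ - _); apply: (ge0_integral_off mN N0) => // x /fgN;
  rewrite ?funeposE ?funenegE => ->.
Qed.

End AeIntegral.

Section SquareIntegrable.
Context {R : realType}.
Implicit Types (f g h : R -> R).

Notation mu := (@lebesgue_measure R).
Notation I0 := (`]0, +oo[%classic : set R).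

Definition sq_integrable f :=
  measurable_fun I0 f /\ (\int[mu]_(x in I0) (f x ^+ 2)%:E < +oo)%E.

Lemma sq_integrableE f : sq_integrable f ->
  mu.-integrable I0 (fun x => (f x ^+ 2)%:E).
Proof.
move=> [mf fi]; apply/integrableP; split.
  by apply/measurable_EFinP; exact: measurable_funX.
by under eq_integral do rewrite gee0_abs ?lee_fin ?sqr_ge0//.
Qed.

Lemma sq_integrable_mul f g : sq_integrable f -> sq_integrable g ->
  mu.-integrable I0 (fun x => (f x * g x)%:E).
Proof.
move=> sf sg.
have : mu.-integrable I0 ((fun x => (f x ^+ 2)%:E) \+ (fun x => (g x ^+ 2)%:E))%E.
  by apply: integrableD => //; exact: sq_integrableE.
apply: le_integrable => //.
  by apply/measurable_EFinP; apply: measurable_funM; [case: sf|case: sg].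
move=> x _ /=; rewrite lee_fin [leRHS]ger0_norm ?addr_ge0 ?sqr_ge0//.
rewrite ler_norml; apply/andP; split; nra.
Qed.

Lemma sq_integrable_sub f g : sq_integrable f -> sq_integrable g ->
  sq_integrable (f \- g).
Proof.
move=> sf sg; split; first by apply: measurable_funB; [case: sf|case: sg].
apply: (@le_lt_trans _ _ (\int[mu]_(x in I0)
    (2%:E * ((f x ^+ 2)%:E + (g x ^+ 2)%:E)))%E).
  apply: ge0_le_integral => //.
  - by move=> x _; rewrite lee_fin sqr_ge0.
  - apply/measurable_EFinP; apply: measurable_funX; apply: measurable_funB.
      by case: sf.
    by case: sg.
  - apply: measurable_funeM; apply: emeasurable_funD;
      apply/measurable_EFinP; apply: measurable_funX; [by case: sf|by case: sg].
  - by move=> x _; rewrite -EFinD -EFinM lee_fin /=; have := sqr_ge0 (f x + g x); nra.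
rewrite integralZl//; last first.
  by apply: integrableD => //; exact: sq_integrableE.
rewrite integralD//; [|exact: sq_integrableE..].
by apply: lte_mul_pinfty => //; apply: lte_add_pinfty; [case: sf|case: sg].
Qed.

Definition dot f g : R := fine (\int[mu]_(x in I0) (f x * g x)%:E)%E.

Lemma dotE f g : sq_integrable f -> sq_integrable g ->
  (\int[mu]_(x in I0) (f x * g x)%:E)%E = (dot f g)%:E.
Proof.
move=> sf sg; rewrite /dot fineK//.
by apply: integrable_fin_num => //; exact: sq_integrable_mul.
Qed.

Lemma dotC f g : dot f g = dot g f.
Proof. by rewrite /dot; congr fine; apply: eq_integral => x _; rewrite mulrC. Qed.

Lemma dot_ge0 f : 0 <= dot f f.
Proof. by apply: fine_ge0; apply: integral_ge0 => x _; rewrite lee_fin -expr2 sqr_ge0. Qed.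

Lemma dot_subl f g h : sq_integrable f -> sq_integrable g -> sq_integrable h ->
  dot (f \- g) h = dot f h - dot g h.
Proof.
move=> sf sg sh; apply: EFin_inj; rewrite EFinB -!dotE//; last exact: sq_integrable_sub.
rewrite -integralB//; [|exact: sq_integrable_mul..].
by apply: eq_integral => x _; rewrite -EFinB mulrBl.
Qed.

Lemma ae_dot_ext f f' g : {ae mu, forall x, I0 x -> f x = f' x} ->
  dot f g = dot f' g.
Proof.
move=> ff; rewrite /dot; congr fine; apply: ae_integral_ext.
move: ff; apply: filterS; first exact: (ae_filter_ringOfSetsType mu).
by move=> x /[apply] ->.
Qed.

End SquareIntegrable.

Section BesselDomain.
Context {R : realType}.
Implicit Types (u v w z : R -> R) (lam s t x : R).

Notation mu := (@lebesgue_measure R).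
Notation I0 := (`]0, +oo[%classic : set R).
Notation du u := (upper_derivative u).

Lemma AC_loc_sub u v : AC_loc u -> AC_loc v -> AC_loc (u \- v).
Proof.
move=> acu acv a b a0 ab e e0.
have e20 : 0 < e / 2 by rewrite divr_gt0.
have [d1 d10 H1] := acu _ _ a0 ab _ e20; have [d2 d20 H2] := acv _ _ a0 ab _ e20.
exists (Num.min d1 d2); first by rewrite lt_min d10.
move=> n s t st tI; rewrite lt_min => /andP[l1 l2].
apply: (@le_lt_trans _ _ (\sum_(i < n) `|u (t i) - u (s i)| +
   \sum_(i < n) `|v (t i) - v (s i)|)); last first.
  by have := H1 _ _ _ st tI l1; have := H2 _ _ _ st tI l2; lra.
rewrite -big_split/=; apply: ler_sum => i _.
have -> : u (t i) - v (t i) - (u (s i) - v (s i)) =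
  (u (t i) - u (s i)) - (v (t i) - v (s i)) by ring.
exact: ler_normB.
Qed.

Lemma upper_derivative_sub u v : AC_loc u -> AC_loc v ->
  {ae mu, forall x, I0 x -> du (u \- v) x = du u x - du v x}.
Proof.
move=> acu acv; have := AC_loc_derive acv; have := AC_loc_derive acu.
apply: filterS2; first exact: (ae_filter_ringOfSetsType mu).
move=> x dux dvx; rewrite /= in_itv/= andbT => x0.
by apply: upper_derivative_is_derive; apply: is_deriveB; [exact: dux|exact: dvx].
Qed.

(** In terms of x u and x u' both summands of the form are inner products in L^2(dx)
    on the half-line. *)
Definition xfun u x : R := x * u x.
Definition xder u x : R := x * du u x.

Lemma bessel_dot u v : AC_loc u -> AC_loc v ->
  bessel u v = (\int[mu]_(x in I0) (xder u x * xder v x)%:E)%E.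
Proof.
move=> acu acv; apply: ae_integral_ext.
have := AC_loc_derive acv; have := AC_loc_derive acu.
apply: filterS2; first exact: (ae_filter_ringOfSetsType mu).
move=> x dux dvx; rewrite /= in_itv/= andbT => x0.
have [du1 _] := dux x0; have [dv1 _] := dvx x0.
rewrite /xder !upper_derivativeE//; congr EFin; ring.
Qed.

Lemma ip_m_dot u v : ip_m u v =
  (\int[mu]_(x in I0) (2%:E * (xfun u x * xfun v x)%:E))%E.
Proof. by apply: eq_integral => x _; rewrite -EFinM /xfun; congr EFin; ring. Qed.

Lemma measurable_xfun u : measurable_fun I0 u -> measurable_fun I0 (xfun u).
Proof. by move=> mu; apply: measurable_funM. Qed.

Lemma measurable_xder u : AC_loc u -> measurable_fun I0 (xder u).
Proof.
move=> ac; apply: measurable_funM => //; apply: measurable_upper_derivative.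
exact: AC_loc_continuous.
Qed.

Lemma AC_loc_measurable u : AC_loc u -> measurable_fun I0 u.
Proof.
move=> ac; apply: open_continuous_measurable_fun; first exact: interval_open.
exact: AC_loc_continuous.
Qed.

Lemma bessel_domP u : bessel_dom u <->
  [/\ AC_loc u, sq_integrable (xfun u) & sq_integrable (xder u)].
Proof.
split=> [[ac [mu1 mu2] bu]|[ac [mu1 mu2] [mb bu]]].
  split => //; split; [exact: measurable_xfun| |exact: measurable_xder|].
    move: mu2; rewrite ip_m_dot ge0_integralZl//; last 2 first.
    - by apply/measurable_EFinP; apply: measurable_funM; exact: measurable_xfun.
    - by move=> x _; rewrite lee_fin -expr2 sqr_ge0.
    under eq_integral do rewrite -expr2.
    apply: contraTT; rewrite -!leNgt !leye_eq => /eqP ->.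
    by rewrite gt0_muley// lte_fin.
  by move: bu; rewrite bessel_dot//; under eq_integral do rewrite -expr2.
split => //; last by rewrite bessel_dot//; under eq_integral do rewrite -expr2.
split; first exact: AC_loc_measurable.
rewrite ip_m_dot ge0_integralZl//; last 2 first.
- by apply/measurable_EFinP; apply: measurable_funM.
- by move=> x _; rewrite lee_fin -expr2 sqr_ge0.
by under eq_integral do rewrite -expr2; exact: lte_mul_pinfty.
Qed.

Lemma bessel_dom_sub u v : bessel_dom u -> bessel_dom v -> bessel_dom (u \- v).
Proof.
move=> /bessel_domP[acu su eu] /bessel_domP[acv sv ev].
have acuv := AC_loc_sub acu acv.
apply/bessel_domP; split => //.
  have -> : xfun (u \- v) = xfun u \- xfun v.
    by apply/funext => x; rewrite /xfun/= mulrBr.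
  exact: sq_integrable_sub.
split; first exact: measurable_xder.
have [_] := sq_integrable_sub eu ev; apply: le_lt_trans.
rewrite le_eqVlt; apply/orP; left; apply/eqP; apply: ae_integral_ext.
have := upper_derivative_sub acu acv.
apply: filterS; first exact: (ae_filter_ringOfSetsType mu).
by move=> x /[apply] h; rewrite /xder h/= mulrBr.
Qed.

Definition energy lam u v : R :=
  dot (xder u) (xder v) + lam * (2 * dot (xfun u) (xfun v)).

Lemma bessel_lamE lam u v : bessel_dom u -> bessel_dom v ->
  bessel_lam lam u v = (energy lam u v)%:E.
Proof.
move=> /bessel_domP[acu su eu] /bessel_domP[acv sv ev].
rewrite /bessel_lam bessel_dot// dotE// ip_m_dot integralZl//.
  by rewrite dotE// -!EFinM -EFinD.
exact: sq_integrable_mul.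
Qed.

Lemma energyC lam u v : energy lam u v = energy lam v u.
Proof. by rewrite /energy dotC (dotC (xfun u)). Qed.

Lemma energy_ge0 lam u : 0 <= lam -> 0 <= energy lam u u.
Proof. by move=> l0; rewrite addr_ge0 ?mulr_ge0 ?dot_ge0. Qed.

Lemma energy_subl lam u v w : bessel_dom u -> bessel_dom v -> bessel_dom w ->
  energy lam (u \- v) w = energy lam u w - energy lam v w.
Proof.
move=> /bessel_domP[acu su eu] /bessel_domP[acv sv ev] /bessel_domP[acw sw ew].
rewrite /energy.
have -> : dot (xder (u \- v)) (xder w) = dot (xder u \- xder v) (xder w).
  apply: ae_dot_ext; have := upper_derivative_sub acu acv.
  apply: filterS; first exact: (ae_filter_ringOfSetsType mu).
  by move=> x /[apply] h; rewrite /xder h/= mulrBr.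
have -> : xfun (u \- v) = xfun u \- xfun v.
  by apply/funext => x; rewrite /xfun/= mulrBr.
rewrite !dot_subl//; ring.
Qed.

Lemma energy_subr lam u v w : bessel_dom u -> bessel_dom v -> bessel_dom w ->
  energy lam w (u \- v) = energy lam w u - energy lam w v.
Proof. by move=> *; rewrite energyC energy_subl// !(energyC _ w). Qed.

End BesselDomain.

(** * Estimates for functions of finite energy *)

Section Estimates.
Context {R : realType}.
Implicit Types (u v w z : R -> R) (lam s t x : R).

Notation mu := (@lebesgue_measure R).
Notation I0 := (`]0, +oo[%classic : set R).

Lemma lipschitz_AC_on a b L u :
  (forall x y, a <= x -> x <= y -> y <= b -> `|u y - u x| <= L * (y - x)) ->
  AC_on a b u.
Proof.
move=> uL e e0; have L0 : 0 < `|L| + 1 by rewrite ltr_wpDl.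
exists (e / (`|L| + 1)); first by rewrite divr_gt0.
move=> n s t st _; rewrite ltr_pdivlMr// => h; apply: le_lt_trans h.
rewrite mulr_suml; apply: ler_sum => i _; have [as_ [sit tb]] := st i (ltn_ord i).
apply: (le_trans (uL _ _ as_ sit tb)); rewrite mulrC ler_wpM2l ?subr_ge0//.
by apply: le_trans (ler_norm _) _; rewrite lerDl.
Qed.

(** The fundamental theorem of calculus for - 1 / x. *)
Lemma integral_inv_sqr s t : 0 < s -> s <= t ->
  mu.-integrable `]s, t] (fun x => (x ^- 2)%:E) /\
  (\int[mu]_(x in `]s, t]) (x ^- 2)%:E)%E = (s^-1 - t^-1)%:E.
Proof.
move=> s0 st; pose w (x : R) := - x^-1.
have acw : AC_loc w.
  move=> a b a0 ab; apply: (@lipschitz_AC_on _ _ (a ^- 2)) => x y ax xy yb.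
  have x0 := lt_le_trans a0 ax; have y0 := lt_le_trans x0 xy.
  have -> : w y - w x = (x * y)^-1 * (y - x) by rewrite /w; field; rewrite !gt_eqF.
  rewrite normrM ger0_norm ?invr_ge0 ?mulr_ge0 ?(ltW x0) ?(ltW y0)// (ger0_norm (_ : 0 <= y - x)) ?subr_ge0//.
  rewrite ler_wpM2r ?subr_ge0// lef_pV2 ?posrE ?mulr_gt0 ?exprn_gt0// expr2.
  by apply: ler_pM => //; [exact: ltW|exact: ltW|exact: le_trans xy].
have wE x : 0 < x -> upper_derivative w x = x ^- 2.
  move=> x0; apply: upper_derivative_is_derive.
  have x0' : x != 0 by rewrite gt_eqF.
  have := @is_deriveN _ _ _ _ _ _ _ (@is_deriveV _ id x 1 1 x0' (is_derive_id _ _)).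
  by rewrite scaleNr opprK /GRing.scale/= mulr1.
have [iw eqw] := AC_loc_integral acw s0 st.
have D0 x : x \in (`]s, t]%classic : set R) -> 0 < x.
  by rewrite inE/= in_itv/= => /andP[sx _]; exact: lt_trans sx.
split.
  by apply: eq_integrable iw => // x /D0 x0; rewrite /= wE.
under eq_integral => x /D0 x0 do rewrite -wE//.
by rewrite -eqw; congr EFin; rewrite /w opprK addrC.
Qed.

Lemma subset_I0 s t : 0 <= s -> (`]s, t]%classic : set R) `<=` I0.
Proof.
by move=> s0 x /=; rewrite !in_itv/= andbT => /andP[sx _]; exact: le_lt_trans sx.
Qed.

Definition piece f s t : R := fine (\int[mu]_(x in `]s, t]) (f x ^+ 2)%:E)%E.

Lemma pieceE f s t : sq_integrable f -> 0 <= s ->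
  (\int[mu]_(x in `]s, t]) (f x ^+ 2)%:E)%E = (piece f s t)%:E.
Proof.
move=> sf s0; rewrite /piece fineK//; apply: integrable_fin_num => //.
apply: integrableS (sq_integrableE sf) => //; exact: subset_I0.
Qed.

Lemma piece_ge0 f s t : 0 <= piece f s t.
Proof. by apply: fine_ge0; apply: integral_ge0 => x _; rewrite lee_fin sqr_ge0. Qed.

Lemma piece_subset f s t s' t' : sq_integrable f -> 0 <= s -> s <= s' -> t' <= t ->
  piece f s' t' <= piece f s t.
Proof.
move=> sf s0 ss tt; rewrite -lee_fin -!pieceE//; last exact: le_trans ss.
apply: ge0_subset_integral => //.
- apply/measurable_EFinP; apply: measurable_funX.
  by apply: measurable_funS sf.1 => //; exact: subset_I0.
- by move=> x _; rewrite lee_fin sqr_ge0.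
- by apply: subset_itv; rewrite bnd_simp.
Qed.

Lemma piece_le_dot f s t : sq_integrable f -> 0 <= s -> piece f s t <= dot f f.
Proof.
move=> sf s0; rewrite -lee_fin -pieceE// -dotE//.
under [leRHS]eq_integral do rewrite -expr2.
apply: ge0_subset_integral => //.
- by apply/measurable_EFinP; apply: measurable_funX; case: sf.
- by move=> x _; rewrite lee_fin sqr_ge0.
- exact: subset_I0.
Qed.

(** The Cauchy-Schwarz inequality for u' = (x u') / x, obtained by minimizing
    the integral of (x u' - c / x)^2 over c. *)
Lemma oscillation_le u s t : bessel_dom u -> 0 < s -> s <= t ->
  (u t - u s) ^+ 2 <= (s^-1 - t^-1) * piece (xder u) s t.
Proof.
move=> /bessel_domP[ac _ sq] s0; rewrite le_eqVlt => /predU1P[<-|st].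
  by rewrite !subrr expr0n mul0r.
have [iu uE] := AC_loc_integral ac s0 (ltW st).
have [ii iE] := integral_inv_sqr s0 (ltW st).
have isq : mu.-integrable `]s, t] (fun x => (xder u x ^+ 2)%:E).
  apply: integrableS (sq_integrableE sq) => //; exact/subset_I0/ltW.
set k := s^-1 - t^-1; set del := u t - u s.
have k0 : 0 < k by rewrite subr_gt0 ltf_pV2// posrE (lt_trans s0).
pose c := del / k.
have : (0 <= \int[mu]_(x in `]s, t]) ((xder u x - c / x) ^+ 2)%:E)%E.
  by apply: integral_ge0 => x _; rewrite lee_fin sqr_ge0.
have -> : (\int[mu]_(x in `]s, t]) ((xder u x - c / x) ^+ 2)%:E =
   \int[mu]_(x in `]s, t]) ((xder u x ^+ 2)%:E + ((- (2 * c))%:E *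
     (upper_derivative u x)%:E + (c ^+ 2)%:E * (x ^- 2)%:E)))%E.
  apply: eq_integral => x; rewrite inE/= in_itv/= => /andP[sx _].
  have x0 : x != 0 by rewrite gt_eqF// (lt_trans s0).
  by rewrite -!EFinM -!EFinD; congr EFin; rewrite /xder; field.
rewrite integralD//=; last by apply: integrableD => //; exact: integrableZl.
rewrite integralD//=; [|exact: integrableZl..].
rewrite integralZl// integralZl// pieceE//; last exact: ltW.
rewrite -uE iE -!EFinM -!EFinD lee_fin -/k -/del => h.
have := h; rewrite (_ : _ + _ = piece (xder u) s t - del ^+ 2 / k); last first.
  by rewrite /c; field; rewrite gt_eqF.
by rewrite subr_ge0 ler_pdivrMr// mulrC.
Qed.

Lemma bigcup_unit_itv : \bigcup_(k : nat) `]k%:R, k.+1%:R]%classic = I0.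
Proof.
apply/seteqP; split => [x [k _ /=]|x /=]; rewrite !in_itv/= andbT.
  by move=> /andP[kx _]; exact: le_lt_trans kx.
move=> x0; have [k xk] : exists k, x <= k.+1%:R.
  exists (Num.bound x); apply: ltW; apply: lt_trans (archi_boundP (ltW x0)) _.
  by rewrite ltr_nat.
have ex : exists k, x <= k.+1%:R by exists k.
case: (ex_minnP ex) => n xn nmin; exists n => //=; rewrite in_itv/= xn andbT.
case: n xn nmin => [//|n] xn nmin; rewrite ltNge; apply/negP => /nmin.
by rewrite ltnn.
Qed.

Lemma trivIset_unit_itv :
  trivIset [set: nat] (fun k => `]k%:R, k.+1%:R]%classic : set R).
Proof.
move=> i j _ _ [x [/=]]; rewrite !in_itv/= => /andP[ix xi] /andP[jx xj].
apply/eqP; rewrite eqn_leq -ltnS -(ltr_nat R) (lt_le_trans ix xj)/=.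
by rewrite -ltnS -(ltr_nat R) (lt_le_trans jx xi).
Qed.

Lemma ge0_integral_pieces (h : R -> R) : measurable_fun I0 h ->
  (forall x, 0 <= h x) ->
  (\int[mu]_(x in I0) (h x)%:E =
   \sum_(0 <= k <oo) \int[mu]_(x in `]k%:R, k.+1%:R]) (h x)%:E)%E.
Proof.
move=> mh h0; rewrite -bigcup_unit_itv; apply: ge0_integral_bigcup => //.
- by rewrite bigcup_unit_itv; apply/measurable_EFinP.
- by move=> x _; rewrite lee_fin.
- exact: trivIset_unit_itv.
Qed.

Lemma dot_pieces f : sq_integrable f ->
  (dot f f)%:E = (\sum_(0 <= k <oo) (piece f k%:R k.+1%:R)%:E)%E.
Proof.
move=> sf; rewrite -dotE//; under eq_integral do rewrite -expr2.
rewrite ge0_integral_pieces; last 2 first.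
- by apply: measurable_funX; case: sf.
- by move=> x; exact: sqr_ge0.
by apply: eq_eseriesr => k _; rewrite pieceE.
Qed.

Lemma sum_pieces_le f m n : sq_integrable f ->
  \sum_(m <= k < n) piece f k%:R k.+1%:R <= dot f f.
Proof.
move=> sf; rewrite -lee_fin dot_pieces//.
apply: le_trans (nneseries_lim_ge n _) => //; last first.
  by move=> *; rewrite lee_fin piece_ge0.
rewrite sumEFin lee_fin.
have [mn|nm] := leqP m n; last by rewrite big_geq ?(ltnW nm)// sumr_ge0// => *; exact: piece_ge0.
by rewrite [leRHS](big_cat_nat (n := m))//= lerDr sumr_ge0// => *; exact: piece_ge0.
Qed.

(** On [k, k+1] the oscillation estimate has the constant 1/k - 1/(k+1) = 1/(k(k+1)). *)
Lemma Q_term_le u k : (0 < k)%N -> bessel_dom u ->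
  k%:R * k.+1%:R * (J u k.+1 - J u k) ^+ 2 <= piece (xder u) k%:R k.+1%:R.
Proof.
move=> k0 du; have k0' : 0 < k%:R :> R by rewrite ltr0n.
have := oscillation_le du k0' (_ : k%:R <= k.+1%:R); rewrite ler_nat leqnSn => /(_ erefl).
rewrite /J (_ : k%:R^-1 - k.+1%:R^-1 = (k%:R * k.+1%:R)^-1); last first.
  by rewrite -natr1; field; rewrite natr1 pnatr_eq0/= gt_eqF.
by rewrite mulrC ler_pdivlMr ?mulr_gt0// mulrC.
Qed.

Lemma Q_le_energy u : bessel_dom u -> (Q (J u) <= (dot (xder u) (xder u))%:E)%E.
Proof.
move=> du; have /bessel_domP[_ _ sq] := du.
apply: lime_le.
  by apply: is_cvg_nneseries => k k1 _; rewrite lee_fin mulr_ge0 ?sqr_ge0.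
apply: nearW => n; rewrite sumEFin lee_fin; apply: le_trans (sum_pieces_le 1 n sq).
rewrite big_nat [leRHS]big_nat; apply: ler_sum => k /andP[k1 _]; exact: Q_term_le.
Qed.

(** For x in (k, k+1] the square of u(x) - u(k) is at most 1/(k(k+1)) times the energy
    on this interval, so (k u(k))^2 is controlled by (x u(x))^2 and the energy; the
    bound follows by integrating over x. *)
Lemma sample_sqr_le u k : (0 < k)%N -> bessel_dom u ->
  (k%:R * J u k) ^+ 2 <= 2 * piece (xfun u) k%:R k.+1%:R +
                         2 * piece (xder u) k%:R k.+1%:R.
Proof.
move=> k0 dm; have k0' : 0 < k%:R :> R by rewrite ltr0n.
have /bessel_domP[_ sf sd] := dm.
set A := piece (xder u) _ _.
have pt x : k%:R < x -> x <= k.+1%:R -> (k%:R * J u k) ^+ 2 <= 2 * xfun u x ^+ 2 + 2 * A.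
  move=> kx xk; have x0 := lt_trans k0' kx.
  have := oscillation_le dm k0' (ltW kx).
  have pA : piece (xder u) k%:R x <= A by apply: piece_subset.
  have A0 : 0 <= A by exact: piece_ge0.
  move=> h.
  have h2 : (u x - u k%:R) ^+ 2 <= (k%:R^-1 - x^-1) * A.
    apply: (le_trans h); rewrite ler_wpM2l// subr_ge0 lef_pV2 ?posrE//; exact: ltW.
  have h3 : k%:R ^+ 2 * (k%:R^-1 - x^-1) <= 1.
    have -> : k%:R ^+ 2 * (k%:R^-1 - x^-1) = k%:R * (x - k%:R) / x.
      by field; rewrite !gt_eqF.
    rewrite ler_pdivrMr// mul1r; move: xk; rewrite -natr1 => xk.
    have := ltW kx; nra.
  have h4 : k%:R ^+ 2 * (u x - u k%:R) ^+ 2 <= A.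
    apply: (@le_trans _ _ (k%:R ^+ 2 * ((k%:R^-1 - x^-1) * A))).
      by rewrite ler_wpM2l ?sqr_ge0.
    by rewrite mulrA -[leRHS]mul1r ler_wpM2r.
  have h5 : (k%:R * u x) ^+ 2 <= (x * u x) ^+ 2.
    by rewrite !exprMn ler_wpM2r ?sqr_ge0// ler_pXn2r ?nnegrE ?ltW.
  rewrite /J /xfun exprMn.
  have := sqr_ge0 (k%:R * (2 * u x - u k%:R)); nra.
have kk : mu `]k%:R, k.+1%:R]%classic = 1%E.
  by rewrite lebesgue_measure_itv/= lte_fin ltr_nat ltnSn -EFinB -natr1 addrAC subrr add0r.
rewrite -lee_fin -[leLHS]mule1 -kk -integral_cst//.
have isf : mu.-integrable `]k%:R, k.+1%:R] (fun x => (xfun u x ^+ 2)%:E).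
  apply: integrableS (sq_integrableE sf) => //; exact: subset_I0.
have icst : mu.-integrable `]k%:R, k.+1%:R] (fun=> (2 * A)%:E).
  apply/integrableP; split; first exact: measurable_cst.
  by rewrite /= integral_cst//= [X in (_ * X)%E]kk mule1 ltry.
rewrite (_ : (2 * _ + 2 * A)%:E = (\int[mu]_(x in `]k%:R, k.+1%:R])
    (2%:E * (xfun u x ^+ 2)%:E + (2 * A)%:E))%E); last first.
  rewrite integralD//; last exact: integrableZl.
  by rewrite integralZl// pieceE// integral_cst//= [X in ((2 * A)%:E * X)%E]kk mule1.
apply: ge0_le_integral => //.
- by move=> x _; rewrite lee_fin sqr_ge0.
- apply: emeasurable_funD => //; apply: measurable_funeM.
  by case/integrableP : isf.
- move=> x /=; rewrite in_itv/= => /andP[kx xk]; rewrite lee_fin; exact: pt.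
Qed.

Lemma sum_sample_sqr_le u n : bessel_dom u ->
  \sum_(1 <= k < n) (k%:R * J u k) ^+ 2 <=
  2 * dot (xfun u) (xfun u) + 2 * dot (xder u) (xder u).
Proof.
move=> du; have /bessel_domP[_ sf sd] := du.
apply: (@le_trans _ _ (\sum_(1 <= k < n) (2 * piece (xfun u) k%:R k.+1%:R +
   2 * piece (xder u) k%:R k.+1%:R))).
  rewrite big_nat [leRHS]big_nat; apply: ler_sum => k /andP[k1 _].
  exact: sample_sqr_le.
by rewrite big_split/= -!mulr_sumr lerD// ler_wpM2l// sum_pieces_le.
Qed.

End Estimates.

(** * Interpolation of a sequence *)

Section Interpolation.
Context {R : realType}.
Implicit Types (x y t : R) (k : nat).

Notation mu := (@lebesgue_measure R).
Notation I0 := (`]0, +oo[%classic : set R).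

Lemma derive_bounded_lipschitz (f df : R -> R) (L a b : R) :
  (forall x, a <= x -> x <= b -> is_derive x 1 f (df x)) ->
  (forall x, a <= x -> x <= b -> `|df x| <= L) ->
  forall x y, a <= x -> x <= y -> y <= b -> `|f y - f x| <= L * (y - x).
Proof.
move=> fd dfL x y ax xy yb.
have inxy z : z \in `[x, y] -> a <= z /\ z <= b.
  by rewrite in_itv/= => /andP[xz zy]; rewrite (le_trans ax xz) (le_trans zy yb).
have [||z zxy ->] := @MVT_segment R f df x y xy.
- move=> z /subset_itv_oo_cc /inxy[az zb]; exact: fd.
- apply: derivable_within_continuous => z /inxy[az zb].
  by have [] := fd z az zb.
rewrite normrM (ger0_norm (_ : 0 <= y - x)) ?subr_ge0// ler_wpM2r ?subr_ge0//.
by have [az zb] := inxy z zxy; exact: dfL.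
Qed.

(** With w = f / x, the form for w is the form of the one-dimensional Laplacian for f up
    to boundary terms. Hence f is prescribed at the integers by f(k) = k v(k), and in
    between by a profile phi: the identity yields the minimizer for lam = 0, a
    hyperbolic sine the one for lam > 0. *)
Variables (phi dphi : R -> R) (M : R) (v : nat -> R).
Hypotheses (phi0 : phi 0 = 0) (phi1 : phi 1 = 1)
  (phiD : forall t : R, is_derive t 1 phi (dphi t))
  (dphiM : forall t : R, 0 <= t <= 1 -> `|dphi t| <= M)
  (v_sum : exists C, forall n, \sum_(0 <= k < n) (k%:R * v k) ^+ 2 <= C).

Let c k : R := k%:R * v k.

Let c0 : c 0 = 0. Proof. exact: mul0r. Qed.

Let phi_lipschitz x y : 0 <= x -> x <= y -> y <= 1 ->
  `|phi y - phi x| <= M * (y - x).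
Proof.
apply: (@derive_bounded_lipschitz phi dphi M 0 1) => // t t0 t1.
by apply: dphiM; rewrite t0.
Qed.

Let M_ge0 : 0 <= M.
Proof. by apply: le_trans (dphiM (_ : 0 <= 0 <= 1)) => //; rewrite lexx ler01. Qed.

Let phi_le t : 0 <= t -> t <= 1 -> `|phi t| <= M * t.
Proof.
by move=> t0 t1; have := phi_lipschitz (lexx 0) t0 t1; rewrite phi0 !subr0.
Qed.

(** f = x w on [k, k+1], given by a formula that makes sense on the whole line. *)
Definition segment k (x : R) : R :=
  k%:R * v k * phi (k.+1%:R - x) + k.+1%:R * v k.+1 * phi (x - k%:R).

Definition dsegment k (x : R) : R :=
  - (k%:R * v k) * dphi (k.+1%:R - x) + k.+1%:R * v k.+1 * dphi (x - k%:R).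

Lemma sqr_normr x : `|x| ^+ 2 = x ^+ 2.
Proof. by rewrite real_normK// num_real. Qed.

Lemma is_derive_reflect (f : R -> R) (p x l : R) :
  is_derive (p - x) 1 f l -> is_derive x 1 (fun y => f (p - y)) (- l).
Proof.
move=> fl; have d : is_derive x 1 (fun y : R => p - y) (0 - 1).
  exact: is_deriveB.
have -> : - l = l * (0 - 1) by ring.
exact: (@is_derive1_comp _ f (fun y => p - y)).
Qed.

Lemma is_derive_translate (f : R -> R) (p x l : R) :
  is_derive (x - p) 1 f l -> is_derive x 1 (fun y => f (y - p)) l.
Proof.
move=> fl; have d : is_derive x 1 (fun y : R => y - p) (1 - 0).
  exact: is_deriveB.
have -> : l = l * (1 - 0) by ring.
exact: (@is_derive1_comp _ f (fun y => y - p)).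
Qed.

Lemma is_derive_scale (f : R -> R) (p x l : R) :
  is_derive x 1 f l -> is_derive x 1 (fun y => p * f y) (p * l).
Proof. by move=> fl; have := is_deriveZ p fl. Qed.

Lemma segmentD k (x : R) : is_derive x 1 (segment k) (dsegment k x).
Proof.
rewrite /dsegment mulNr -mulrN.
apply: is_deriveD; apply: is_derive_scale.
  exact: is_derive_reflect.
exact: is_derive_translate.
Qed.

Let B k : R := M * (`|c k| + `|c k.+1|).

Let B_ge0 k : 0 <= B k.
Proof. by rewrite mulr_ge0// addr_ge0. Qed.

Let in_unit k x : k%:R <= x -> x <= k.+1%:R ->
  0 <= k.+1%:R - x <= 1 /\ 0 <= x - k%:R <= 1.
Proof. by rewrite -natr1 => ? ?; split; lra. Qed.

Let dsegment_le k x : k%:R <= x -> x <= k.+1%:R -> `|dsegment k x| <= B k.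
Proof.
move=> kx xk; have [h1 h2] := in_unit kx xk.
rewrite /dsegment -/(c k) -/(c k.+1) (le_trans (ler_normD _ _))// /B mulrDr.
rewrite (normrM (- c k)) (normrM (c k.+1)) normrN.
by rewrite lerD// [leRHS]mulrC ler_wpM2l// dphiM.
Qed.

Let segment_le k x : k%:R <= x -> x <= k.+1%:R -> `|segment k x| <= B k.
Proof.
move=> kx xk; have [/andP[h1 h2] /andP[h3 h4]] := in_unit kx xk.
have phiM t : 0 <= t -> t <= 1 -> `|phi t| <= M.
  by move=> t0 t1; rewrite (le_trans (phi_le t0 t1))// ler_piMr.
rewrite /segment -/(c k) -/(c k.+1) (le_trans (ler_normD _ _))// /B mulrDr.
rewrite (normrM (c k)) (normrM (c k.+1)).
by rewrite lerD// [leRHS]mulrC ler_wpM2l// phiM.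
Qed.

(** On [0, 1] the division by x is harmless because f vanishes at 0. *)
Let segment_div_le k x : k%:R <= x -> x <= k.+1%:R -> 0 < x ->
  `|segment k x / x| <= B k.
Proof.
move=> kx xk x0; rewrite normrM normfV (gtr0_norm x0) ler_pdivrMr//.
case: k kx xk => [|k] kx xk.
  rewrite /segment -/(c 0) -/(c 1) /B c0 mul0r add0r subr0 normr0 add0r.
  by rewrite (normrM (c 1)) mulrAC [leRHS]mulrC ler_wpM2l// phi_le// ltW.
rewrite (le_trans (segment_le kx xk))// ler_peMr//.
by apply: le_trans kx; rewrite ler1n.
Qed.

Definition interp (x : R) : R := segment (Num.truncn x) x.

Lemma interpE k x : k%:R <= x -> x <= k.+1%:R -> interp x = segment k x.
Proof.
rewrite /interp => kx; rewrite le_eqVlt => /predU1P[->|xk].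
  have e m : m.+1%:R - m%:R = 1 :> R by rewrite -natr1 addrAC subrr add0r.
  by rewrite natrK /segment !subrr !e phi0 phi1 !mulr0 addr0 add0r.
by rewrite (@truncn_def _ x k)// kx xk.
Qed.

Lemma interp_nat k : interp k%:R = k%:R * v k.
Proof.
rewrite (@interpE k)//; last by rewrite ler_nat.
by rewrite /segment subrr phi0 mulr0 addr0 -natr1 addrAC subrr add0r phi1 mulr1.
Qed.

(** The pieces agree at the integers, so their Lipschitz constants on [0, n] combine;
    the sum of the constants is a convenient upper bound of them all. *)
Let interp_lipschitz n x y : 0 <= x -> x <= y -> y <= n%:R ->
  `|interp y - interp x| <= (\sum_(k < n) B k) * (y - x).
Proof.
elim: n x y => [|n ih] x y x0 xy yn.
  have -> : y = x by lra.
  by rewrite !subrr normr0 mulr0.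
rewrite big_ord_recr/= mulrDl.
have S0 : 0 <= \sum_(k < n) B k by exact: sumr_ge0.
have last_ a b : n%:R <= a -> a <= b -> b <= n.+1%:R ->
    `|interp b - interp a| <= B n * (b - a).
  move=> na ab bn; rewrite !(@interpE n) ?(le_trans na ab) ?(le_trans ab bn)//.
  apply: (@derive_bounded_lipschitz _ (dsegment n) (B n) n%:R n.+1%:R) => // z nz zn.
    exact: segmentD.
  exact: dsegment_le.
have yx : 0 <= y - x by rewrite subr_ge0.
have [xn|nx] := leP x n%:R; last first.
  apply: (le_trans (last_ _ _ (ltW nx) xy yn)).
  by rewrite lerDr mulr_ge0.
have [yn'|ny] := leP y n%:R.
  by apply: (le_trans (ih _ _ x0 xy yn')); rewrite lerDl mulr_ge0.
have h1 := ih _ _ x0 xn (lexx _); have h2 := last_ _ _ (lexx _) (ltW ny) yn.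
have -> : interp y - interp x = (interp n%:R - interp x) + (interp y - interp n%:R) by ring.
apply: (le_trans (ler_normD _ _)); apply: lerD.
  by apply: (le_trans h1); rewrite ler_wpM2l//; lra.
by apply: (le_trans h2); rewrite ler_wpM2l//; lra.
Qed.

(** The value at 0 makes J return v also at the index 0. *)
Definition interpolant (x : R) : R := if x == 0 then v 0%N else interp x / x.

Lemma J_interpolant : J interpolant = v.
Proof.
apply/funext => -[|k]; rewrite /J /interpolant; first by rewrite eqxx.
by rewrite pnatr_eq0/= interp_nat mulrAC divff ?mul1r// pnatr_eq0.
Qed.

Let interpolantE x : 0 < x -> interpolant x = interp x / x.
Proof. by move=> x0; rewrite /interpolant gt_eqF. Qed.

Lemma interpolant_AC : AC_loc interpolant.
Proof.
move=> a b a0 ab; pose n := Num.bound b.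
have b0 := lt_le_trans a0 ab.
have bn : b <= n%:R by exact/ltW/archi_boundP/ltW.
pose L := \sum_(k < n) B k.
have L0 : 0 <= L by exact: sumr_ge0.
apply: (@lipschitz_AC_on _ _ _ (L / a + L * b / a ^+ 2)) => x y ax xy yb.
have x0 := lt_le_trans a0 ax; have y0 := lt_le_trans x0 xy.
have yn := le_trans yb bn.
rewrite !interpolantE//.
have -> : interp y / y - interp x / x =
    (interp y - interp x) / y - interp x * (y - x) / (x * y).
  by field; rewrite !gt_eqF.
have i0 : interp 0 = 0 by rewrite -[0]/(0%:R) interp_nat mul0r.
have hx : `|interp x| <= L * b.
  have := interp_lipschitz (lexx 0) (ltW x0) (le_trans xy yn).
  rewrite i0 !subr0 => /le_trans; apply; rewrite ler_wpM2l//.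
  exact: le_trans yb.
have yx : 0 <= y - x by rewrite subr_ge0.
apply: (le_trans (ler_normB _ _)); rewrite [leRHS]mulrDl; apply: lerD.
  rewrite normrM normfV (gtr0_norm y0) mulrAC.
  apply: ler_pM => //; first by rewrite invr_ge0 ltW.
    exact: interp_lipschitz (ltW x0) xy yn.
  by rewrite lef_pV2 ?posrE// (le_trans ax).
rewrite normrM normfV normrM (ger0_norm yx) (gtr0_norm (mulr_gt0 x0 y0)).
rewrite [leRHS]mulrAC; apply: ler_pM => //.
- by rewrite mulr_ge0.
- by rewrite invr_ge0 mulr_ge0 ?(ltW x0) ?(ltW y0).
- by rewrite ler_wpM2r.
- rewrite lef_pV2 ?posrE ?exprn_gt0 ?mulr_gt0// expr2.
  by apply: ler_pM; rewrite ?(ltW a0)// (le_trans ax).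
Qed.

Lemma xfun_interpolant k x : 0 < x -> k%:R <= x -> x <= k.+1%:R ->
  xfun interpolant x = segment k x.
Proof.
move=> x0 kx xk; rewrite /xfun interpolantE// mulrC divfK ?gt_eqF//.
exact: interpE.
Qed.

Lemma xder_interpolant k x : 0 < x -> k%:R < x -> x < k.+1%:R ->
  xder interpolant x = dsegment k x - segment k x / x.
Proof.
move=> x0 kx xk.
have xn0 : x != 0 by rewrite gt_eqF.
suff -> : xder interpolant x = x * ((dsegment k x - segment k x / x) / x).
  by rewrite mulrC divfK.
congr (_ * _); apply: upper_derivative_is_derive.
have dinv := @is_deriveV _ id x 1 1 xn0 (is_derive_id _ _).
have := is_deriveM (segmentD k x) dinv.
rewrite (_ : segment k x *: _ + _ = (dsegment k x - segment k x / x) / x); last first.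
  by rewrite /GRing.scale/=; field.
apply: near_eq_is_derive; near=> y.
have y0 : 0 < y by near: y; exact: lt_nbhsr.
have ky : k%:R < y by near: y; exact: lt_nbhsr.
have yk : y < k.+1%:R by near: y; exact: lt_nbhsl.
by rewrite interpolantE// (@interpE k) ?ltW.
Unshelve. all: by end_near. Qed.

Lemma ae_unit_itv_interior k (P : R -> Prop) :
  (forall x, 0 < x -> k%:R < x -> x < k.+1%:R -> P x) ->
  {ae mu, forall x, (`]k%:R, k.+1%:R]%classic : set R) x -> P x}.
Proof.
move=> H; exists [set k.+1%:R]; split => //; first exact: lebesgue_measure_set1.
move=> x /= nP; apply: contrapT => xk; apply: nP.
rewrite in_itv/= => /andP[kx kxx]; apply: H => //; first exact: le_lt_trans kx.
by rewrite lt_neqAle kxx andbT; apply/eqP.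
Qed.

Lemma piece_xder_interpolant k :
  piece (xder interpolant) k%:R k.+1%:R =
  fine (\int[mu]_(x in `]k%:R, k.+1%:R])
    ((dsegment k x - segment k x / x) ^+ 2)%:E)%E.
Proof.
congr fine; apply: ae_integral_ext; apply: ae_unit_itv_interior => x x0 kx xk.
by rewrite (xder_interpolant x0 kx xk).
Qed.

Let sum_B2 : exists C, forall n, \sum_(0 <= k < n) (2 * B k) ^+ 2 <= C.
Proof.
have [C HC] := v_sum; exists (16 * M ^+ 2 * C) => n.
have h k : (2 * B k) ^+ 2 <= 8 * M ^+ 2 * (c k ^+ 2 + c k.+1 ^+ 2).
  rewrite /B -(sqr_normr (c k)) -(sqr_normr (c k.+1)) !exprMn.
  have : (`|c k| + `|c k.+1|) ^+ 2 <= 2 * (`|c k| ^+ 2 + `|c k.+1| ^+ 2).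
    by have := sqr_ge0 (`|c k| - `|c k.+1|); nra.
  have := sqr_ge0 M; set a := (_ + _) ^+ 2; set b := _ + _; nra.
apply: (le_trans (ler_sum _ (fun k _ => h k))).
rewrite -mulr_sumr big_split/=.
have h1 := HC n; have : \sum_(0 <= k < n) c k.+1 ^+ 2 <= C.
  apply: le_trans (HC n.+1); rewrite big_nat_recl//= lerDr.
  exact: sqr_ge0.
have := sqr_ge0 M; set s1 := \sum_(0 <= k < n) c k ^+ 2.
set s2 := \sum_(0 <= k < n) _; rewrite -/s1 in h1 *; nra.
Qed.

(** The bounds B k are square summable because the k v(k) are. *)
Let sq_integrable_pieces (f : R -> R) : measurable_fun I0 f ->
  (forall k, {ae mu, forall x, (`]k%:R, k.+1%:R]%classic : set R) x ->
     `|f x| <= 2 * B k}) ->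
  sq_integrable f.
Proof.
move=> mf fB; split => //.
rewrite ge0_integral_pieces//; last 2 first.
- exact: measurable_funX.
- by move=> x; exact: sqr_ge0.
have [C HC] := sum_B2.
apply: (@le_lt_trans _ _ C%:E); last exact: ltry.
apply: lime_le.
  apply: is_cvg_nneseries => k _ _; apply: integral_ge0 => x _.
  by rewrite lee_fin sqr_ge0.
apply: nearW => n; apply: (@le_trans _ _ (\sum_(0 <= k < n) ((2 * B k) ^+ 2)%:E)%E); last first.
  by rewrite sumEFin lee_fin.
apply: lee_sum => k _.
have mk : mu `]k%:R, k.+1%:R]%classic = 1%E.
  by rewrite lebesgue_measure_itv/= lte_fin ltr_nat ltnSn -EFinB -natr1 addrAC subrr add0r.
rewrite -[leRHS]mule1 -mk -integral_cst//.
apply: ae_ge0_le_integral => //.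
- by move=> x _; rewrite lee_fin sqr_ge0.
- apply/measurable_EFinP; apply: measurable_funX.
  by apply: measurable_funS mf => //; exact: subset_I0.
- by move=> x _; rewrite lee_fin sqr_ge0.
have := fB k; apply: filterS; first exact: (ae_filter_ringOfSetsType mu).
move=> x /[apply] h; rewrite lee_fin -[leLHS]sqr_normr.
by rewrite ler_pXn2r ?nnegrE// mulr_ge0.
Qed.

Lemma interpolant_dom : bessel_dom interpolant.
Proof.
have ac := interpolant_AC.
apply/bessel_domP; split => //; apply: sq_integrable_pieces.
- by apply: measurable_xfun; exact: AC_loc_measurable.
- move=> k; apply: ae_unit_itv_interior => x x0 kx xk.
  rewrite (xfun_interpolant x0 (ltW kx) (ltW xk)).
  by have := segment_le (ltW kx) (ltW xk); have := B_ge0 k; lra.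
- exact: measurable_xder.
- move=> k; apply: ae_unit_itv_interior => x x0 kx xk.
  rewrite (xder_interpolant x0 kx xk); apply: (le_trans (ler_normB _ _)).
  have := segment_div_le (ltW kx) (ltW xk) x0.
  by have := dsegment_le (ltW kx) (ltW xk); lra.
Qed.

End Interpolation.

(** * The interpolant of least energy *)

Section Products.
Context {R : realType}.
Implicit Types (x y a b : R) (u v : R -> R).

Notation I0 := (`]0, +oo[%classic : set R).

Lemma continuous_bounded_on a b u : a <= b -> {in `[a, b], continuous u} ->
  exists2 L, 0 < L & forall x, a <= x -> x <= b -> `|u x| <= L.
Proof.
move=> ab cu.
have [|c _ H] := @EVT_max R (fun x => `|u x|) a b ab.
  apply: continuous_in_subspaceT => x /set_mem/= xab.
  by apply: cvg_norm; exact: cu.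
exists (`|u c| + 1); first by rewrite ltr_wpDl.
move=> x ax xb; apply: (le_trans (H x _)); first by rewrite in_itv/= ax.
by rewrite lerDl.
Qed.

Lemma AC_loc_mul u v : AC_loc u -> AC_loc v -> AC_loc (u \* v).
Proof.
move=> acu acv a b a0 ab.
have bnd w : AC_loc w -> exists2 L, 0 < L & forall x, a <= x -> x <= b -> `|w x| <= L.
  move=> /AC_loc_continuous cw; apply: continuous_bounded_on => // x.
  rewrite in_itv/= => /andP[ax _]; apply: cw.
  by rewrite inE/= in_itv/= andbT; exact: lt_le_trans ax.
have [L L0 uL] := bnd _ acu; have [K K0 vK] := bnd _ acv.
move=> e e0.
have eL : 0 < e / (2 * L) by rewrite divr_gt0// mulr_gt0.
have eK : 0 < e / (2 * K) by rewrite divr_gt0// mulr_gt0.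
have [d1 d10 H1] := acu _ _ a0 ab _ eK; have [d2 d20 H2] := acv _ _ a0 ab _ eL.
exists (Num.min d1 d2); first by rewrite lt_min d10.
move=> n s t st tI; rewrite lt_min => /andP[l1 l2].
apply: (@le_lt_trans _ _ (K * (\sum_(i < n) `|u (t i) - u (s i)|) +
   L * \sum_(i < n) `|v (t i) - v (s i)|)).
  rewrite !mulr_sumr -big_split/=; apply: ler_sum => i _.
  have [as_ [sit tb]] := st i (ltn_ord i).
  have -> : u (t i) * v (t i) - u (s i) * v (s i) =
    v (t i) * (u (t i) - u (s i)) + u (s i) * (v (t i) - v (s i)) by ring.
  rewrite (le_trans (ler_normD _ _))// !normrM lerD// ler_wpM2r//.
    by apply: vK => //; exact: le_trans sit.
  by apply: uL => //; exact: le_trans tb.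
have := H1 _ _ _ st tI l1; have := H2 _ _ _ st tI l2.
rewrite !ltr_pdivlMr ?mulr_gt0//; set s1 := \sum_(_ < _) _; set s2 := \sum_(_ < _) _.
lra.
Qed.

Lemma AC_loc_C1 u (du : R -> R) : (forall x, is_derive x 1 u (du x)) ->
  continuous du -> AC_loc u.
Proof.
move=> ud cdu a b a0 ab.
have [|L L0 duL] := @continuous_bounded_on a b du ab.
  by move=> x _; exact: cdu.
apply: (@lipschitz_AC_on _ _ _ L) => x y.
by apply: (@derive_bounded_lipschitz _ u du L a b).
Qed.

End Products.

Section LinearInterpolation.
Context {R : realType}.
Variable v : nat -> R.
Hypothesis v_sum : exists C, forall n, \sum_(0 <= k < n) (k%:R * v k) ^+ 2 <= C.

Notation mu := (@lebesgue_measure R).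

(** Linear interpolation of x w makes w of the form A + B / x between consecutive
    integers, which solves (x^2 w')' = 0. *)
Definition harmonic_interpolant : R -> R := interpolant id v.

Let one_le (t : R) : 0 <= t <= 1 -> `|(fun _ : R => 1 : R) t| <= 1.
Proof. by rewrite normr1. Qed.

Lemma harmonic_interpolant_dom : bessel_dom harmonic_interpolant.
Proof. exact: (@interpolant_dom _ id (fun=> 1) 1). Qed.

Lemma J_harmonic_interpolant : J harmonic_interpolant = v.
Proof. exact: (@J_interpolant _ id v). Qed.

(** Here x w' = q / x with q = k (k+1) (v(k+1) - v(k)), and the square of q
    is multiplied by 1/k - 1/(k+1). *)
Lemma harmonic_piece k : piece (xder harmonic_interpolant) k%:R k.+1%:R =
  k%:R * k.+1%:R * (v k.+1 - v k) ^+ 2.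
Proof.
rewrite /harmonic_interpolant (@piece_xder_interpolant _ id (fun=> 1))//.
pose q : R := k%:R * k.+1%:R * (v k.+1 - v k).
have -> : (\int[mu]_(x in `]k%:R, k.+1%:R])
    ((dsegment (fun=> 1) v k x - segment id v k x / x) ^+ 2)%:E =
  \int[mu]_(x in `]k%:R, k.+1%:R]) ((q ^+ 2)%:E * (x ^- 2)%:E))%E.
  apply: eq_integral => x; rewrite inE/= in_itv/= => /andP[kx _].
  have x0 : x != 0 by rewrite gt_eqF// (le_lt_trans _ kx).
  rewrite -EFinM; congr EFin; rewrite /dsegment /segment /q /=.
  by rewrite -natr1; field.
have [k0|k0] := posnP k.
  have -> : q = 0 by rewrite /q k0 !mul0r.
  rewrite expr0n/= (eq_integral (cst 0%E)); last by move=> x _; rewrite mul0e.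
  by rewrite integral0 k0 !mul0r.
have k0' : 0 < k%:R :> R by rewrite ltr0n.
have kk1 : k%:R <= k.+1%:R :> R by rewrite ler_nat.
have [ii iE] := integral_inv_sqr k0' kk1.
have kn0 : k%:R != 0 :> R by rewrite gt_eqF.
have k1n0 : k%:R + 1 != 0 :> R by rewrite natr1 pnatr_eq0.
by rewrite integralZl// iE -EFinM /q/= -natr1; field; rewrite ?k1n0 ?kn0.
Qed.

Lemma harmonic_energy : (dot (xder harmonic_interpolant)
  (xder harmonic_interpolant))%:E = Q v.
Proof.
have /bessel_domP[_ _ sd] := harmonic_interpolant_dom.
rewrite dot_pieces// /Q; congr (limn _); apply/funext => n.
case: n => [|n]; first by rewrite !big_geq.
rewrite big_ltn//= harmonic_piece !mul0r add0e.
by apply: eq_bigr => k _; rewrite harmonic_piece.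
Qed.

End LinearInterpolation.

(** * Orthogonality to the functions vanishing on the integers *)

Section Orthogonality.
Context {R : realType}.
Implicit Types (x y t : R) (k : nat) (z : R -> R).
Variables (phi dphi : R -> R) (M lam : R) (v : nat -> R).
Hypotheses (phi0 : phi 0 = 0) (phi1 : phi 1 = 1)
  (phiD : forall t : R, is_derive t 1 phi (dphi t))
  (dphiM : forall t : R, 0 <= t <= 1 -> `|dphi t| <= M)
  (dphiD : forall t : R, is_derive t 1 dphi (2 * lam * phi t))
  (v_sum : exists C, forall n, \sum_(0 <= k < n) (k%:R * v k) ^+ 2 <= C).

Notation mu := (@lebesgue_measure R).
Notation I0 := (`]0, +oo[%classic : set R).

Let w := interpolant phi v.

Let w_dom : bessel_dom w.
Proof. exact: (@interpolant_dom _ phi dphi M). Qed.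

Let dsegmentD k x :
  is_derive x 1 (dsegment dphi v k) (2 * lam * segment phi v k x).
Proof.
rewrite /dsegment.
have -> : 2 * lam * segment phi v k x =
    - (k%:R * v k) * - (2 * lam * phi (k.+1%:R - x)) +
    k.+1%:R * v k.+1 * (2 * lam * phi (x - k%:R)) by rewrite /segment; ring.
apply: is_deriveD; apply: is_derive_scale.
  exact: is_derive_reflect.
exact: is_derive_translate.
Qed.

(** x^2 w' on [k, k+1]; the form with parameter lam has the Euler-Lagrange equation
    (x^2 w')' = 2 lam x^2 w. *)
Let flux k x := x * dsegment dphi v k x - segment phi v k x.

Let fluxD k x : is_derive x 1 (flux k) (x * (2 * lam * segment phi v k x)).
Proof.
have dx := is_deriveM (is_derive_id x 1) (dsegmentD k x).
have := is_deriveB dx (@segmentD _ phi dphi v phiD k x).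
by rewrite (_ : _ - _ = x * (2 * lam * segment phi v k x))//= /GRing.scale/=; ring.
Qed.

Let flux_AC k : AC_loc (flux k).
Proof.
apply: (AC_loc_C1 (fluxD k)) => x.
have cs : {for x, continuous (segment phi v k)}.
  apply/differentiable_continuous/derivable1_diffP.
  by have [] := @segmentD _ phi dphi v phiD k x.
by apply: cvgM; [exact: cvg_id|apply: cvgM => //; exact: cvg_cst].
Qed.

Let density z x := xder w x * xder z x + 2 * lam * (xfun w x * xfun z x).

Let density_integrable z : bessel_dom z ->
  mu.-integrable I0 (fun x => (density z x)%:E).
Proof.
move=> /bessel_domP[_ s1 s2]; have /bessel_domP[_ s3 s4] := w_dom.
rewrite (_ : (fun x => _) = (fun x => (xder w x * xder z x)%:E) \+
  (fun x => (2 * lam)%:E * (xfun w x * xfun z x)%:E))%E//.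
apply: integrableD => //; first exact: sq_integrable_mul.
by apply: integrableZl => //; exact: sq_integrable_mul.
Qed.

(** By the differential equation the density of the form is the derivative of z x^2 w',
    so integration by parts leaves boundary terms only. *)
Let integral_density z k s t : bessel_dom z -> 0 < s -> s <= t -> k%:R <= s -> t <= k.+1%:R ->
  (\int[mu]_(x in `]s, t]) (density z x)%:E)%E = (z t * flux k t - z s * flux k s)%:E.
Proof.
move=> /bessel_domP[acz _ _] s0 st ks tk.
have [_ ->] := AC_loc_integral (AC_loc_mul acz (flux_AC k)) s0 st.
apply: ae_integral_ext.
have sub x : (`]s, t]%classic : set R) x -> (`]k%:R, k.+1%:R]%classic : set R) x.
  rewrite /= !in_itv/= => /andP[sx xt].
  by rewrite (le_lt_trans ks sx) (le_trans xt tk).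
have := AC_loc_derive acz.
have : {ae mu, forall x, (`]k%:R, k.+1%:R]%classic : set R) x ->
    [/\ 0 < x, k%:R < x & x < k.+1%:R]}.
  by apply: ae_unit_itv_interior.
apply: filterS2; first exact: (ae_filter_ringOfSetsType mu).
move=> x kxk dz /sub /kxk[x0 kx xk].
congr EFin.
have := is_deriveM (dz x0) (fluxD k x).
move/upper_derivative_is_derive => ->; rewrite /density /GRing.scale/=.
rewrite (@xder_interpolant _ phi dphi v phi0 phi1 phiD k x x0 kx xk).
rewrite (@xfun_interpolant _ phi v phi0 phi1 k x x0 (ltW kx) (ltW xk)).
by rewrite /flux /xder /xfun; field; rewrite gt_eqF.
Qed.

Let flux0_le x : 0 <= x -> x <= 1 -> `|flux 0 x| <= 2 * `|v 1%N| * M * x.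
Proof.
move=> x0 x1; have phiM : `|phi x| <= M * x.
  have dM t : 0 <= t -> t <= 1 -> `|dphi t| <= M.
    by move=> t0 t1; apply: dphiM; rewrite t0.
  have := @derive_bounded_lipschitz _ phi dphi M 0 1 (fun t _ _ => phiD t)
    dM 0 x (lexx 0) x0 x1.
  by rewrite phi0 !subr0.
have dM : `|dphi x| <= M by apply: dphiM; rewrite x0.
have -> : flux 0 x = x * (v 1%N * dphi x) - v 1%N * phi x.
  by rewrite /flux /dsegment /segment !mulr0n !mul0r !oppr0 !mul0r !add0r !addr0 !mul1r.
rewrite (le_trans (ler_normB _ _))// !normrM (ger0_norm x0).
have := normr_ge0 (v 1%N) => v0.
have h1 : x * (`|v 1%N| * `|dphi x|) <= x * (`|v 1%N| * M).
  by rewrite ler_wpM2l// ler_wpM2l.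
have h2 : `|v 1%N| * `|phi x| <= `|v 1%N| * (M * x) by rewrite ler_wpM2l.
lra.
Qed.

(** At 0 the boundary term z x^2 w' vanishes, because finite energy gives
    z = O(x^(-1/2)) whereas the flux is O(x). *)
Let boundary_cvg0 z : kerJ z ->
  z n.+1%:R^-1 * flux 0 n.+1%:R^-1 @[n --> \oo] --> (0 : R).
Proof.
move=> [dz zk]; have /bessel_domP[_ _ sz] := dz.
pose K := dot (xder z) (xder z) * (2 * `|v 1%N| * M) ^+ 2.
have K0 : 0 <= K by rewrite mulr_ge0 ?dot_ge0 ?sqr_ge0.
have le_K n : (z n.+1%:R^-1 * flux 0 n.+1%:R^-1) ^+ 2 <= K * n.+1%:R^-1.
  set x := n.+1%:R^-1.
  have x0 : 0 < x by rewrite invr_gt0.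
  have x1 : x <= 1 by rewrite invf_le1// ler1n.
  have zx : z x ^+ 2 <= x^-1 * dot (xder z) (xder z).
    have z1 : z 1 = 0 := zk 1%N isT.
    have := oscillation_le dz x0 x1; rewrite z1 sub0r sqrrN invr1.
    move=> /le_trans; apply; apply: ler_pM.
    - by rewrite subr_ge0 invf_ge1.
    - exact: piece_ge0.
    - by rewrite gerBl.
    - exact/piece_le_dot/ltW.
  have fx : flux 0 x ^+ 2 <= (2 * `|v 1%N| * M * x) ^+ 2.
    have h := flux0_le (ltW x0) x1.
    by rewrite -sqr_normr ler_pXn2r ?nnegrE// (le_trans _ h).
  rewrite exprMn; apply: (le_trans (ler_pM (sqr_ge0 _) (sqr_ge0 _) zx fx)).
  rewrite le_eqVlt; apply/orP; left; apply/eqP.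
  by rewrite /K; field; rewrite gt_eqF.
have Kcvg : K * n.+1%:R^-1 @[n --> \oo] --> (0 : R).
  by rewrite -[X in _ --> X](mulr0 K); apply: cvgMr; exact: cvg_harmonic.
apply/cvgrPdist_lt => e e0; have e20 : 0 < e ^+ 2 by rewrite exprn_gt0.
move/cvgrPdist_lt : Kcvg => /(_ _ e20) Ke; near=> n.
rewrite sub0r normrN -(@ltr_pXn2r _ 2)// ?nnegrE ?(ltW e0)// sqr_normr.
apply: le_lt_trans (le_K n) _.
have : `|0 - K * n.+1%:R^-1| < e ^+ 2.
  by near: n.
by rewrite sub0r normrN ger0_norm// mulr_ge0.
Unshelve. all: by end_near. Qed.

(** On (0, 1] the integral is the limit of the integrals over (1/(n+1), 1]. *)
Let integral_density0 z : kerJ z ->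
  (\int[mu]_(x in `]0%:R, 1%:R]) (density z x)%:E = 0)%E.
Proof.
move=> kz; have [dz zk] := kz.
pose D : set R := `]0%:R, 1%:R]%classic.
have mD : measurable D by exact: measurable_itv.
pose P n : set R := `]n.+1%:R^-1, 1%:R]%classic.
have id_ : mu.-integrable D (fun x => (density z x)%:E).
  by apply: integrableS (density_integrable dz) => //; exact: subset_I0.
have [|||||_ _] := @dominated_convergence _ _ R mu D mD
  (fun n => (fun x => (density z x)%:E) \_ (P n)) (fun x => (density z x)%:E)
  (fun x => `|(density z x)%:E|%E).
- move=> n; apply/measurable_restrict => //; first exact: measurable_itv.
  apply: measurable_funS (measurable_int _ id_) => //.
- by case/integrableP : id_.
- apply: aeW => x; rewrite /D/= in_itv/= => /andP[x0 x1].
  apply: cvg_near_cst; near=> n; rewrite patchE mem_set// /P/= in_itv/= x1 andbT.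
  rewrite invf_plt ?posrE//; apply: (@lt_trans _ _ n%:R); last by rewrite ltr_nat.
  near: n; exact: nbhs_infty_gtr.
- exact: integrable_abse.
- apply: aeW => x n _; rewrite patchE; case: ifPn => // _.
  by rewrite abse0 abse_ge0.
have PE n : (\int[mu]_(x in D) (((fun x => (density z x)%:E) \_ (P n)) x))%E
   = (- (z n.+1%:R^-1 * flux 0 n.+1%:R^-1))%:E.
  have n0 : 0 < n.+1%:R^-1 :> R by rewrite invr_gt0.
  have n1 : n.+1%:R^-1 <= 1 :> R by rewrite invf_le1// ler1n.
  rewrite -integral_mkcondr setIidr; last first.
    by move=> x; rewrite /P /D/= !in_itv/= => /andP[h ->]; rewrite (lt_trans n0 h).
  rewrite (@integral_density z 0 n.+1%:R^-1 1%:R dz n0 n1)//; last exact: ltW.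
  by rewrite zk// mul0r sub0r.
rewrite /mkset; under eq_fun do rewrite PE.
move=> h; have := cvgN (boundary_cvg0 kz); rewrite oppr0 => h'.
have h2 : (- (z n.+1%:R^-1 * flux 0 n.+1%:R^-1))%:E @[n --> \oo] --> (0 : R)%:E.
  by apply/cvg_EFin; [exact: nearW|exact: h'].
by rewrite (cvg_unique _ h h2).
Unshelve. all: by end_near. Qed.

(** The boundary terms at the integers vanish with z. *)
Lemma interpolant_orthogonal z : kerJ z -> energy lam w z = 0.
Proof.
move=> kz; have [dz zk] := kz.
have /bessel_domP[_ s1 s2] := dz; have /bessel_domP[_ s3 s4] := w_dom.
apply: EFin_inj; have -> : (energy lam w z)%:E = (\int[mu]_(x in I0) (density z x)%:E)%E.
  transitivity (\int[mu]_(x in I0) ((xder w x * xder z x)%:E +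
    (2 * lam)%:E * (xfun w x * xfun z x)%:E))%E; last exact: eq_integral.
  rewrite integralD//; first 1 last.
  - exact: sq_integrable_mul.
  - by apply: integrableZl => //; exact: sq_integrable_mul.
  rewrite integralZl//; last exact: sq_integrable_mul.
  by rewrite !dotE// -EFinM -EFinD /energy; congr EFin; ring.
rewrite -bigcup_unit_itv integral_bigcup.
- rewrite eseries0// => k _ _; case: k => [|k]; first exact: integral_density0.
  rewrite (@integral_density z k.+1)// ?ler_nat//.
  by rewrite !zk// !mul0r subrr.
- exact: trivIset_unit_itv.
- by move=> k; exact: measurable_itv.
- by rewrite bigcup_unit_itv; exact: density_integrable.
Qed.

End Orthogonality.

(** * Bounds for the trace forms with positive parameter *)

Section TraceBounds.
Context {R : realType}.
Implicit Types (u w z : R -> R) (v : nat -> R) (lam t : R).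

(** The profile sinh (s t) / sinh s with s^2 = 2 lam. *)
Lemma hyperbolic_profile lam : 0 < lam -> exists (phi dphi : R -> R) (M : R),
  [/\ phi 0 = 0, phi 1 = 1, (forall t : R, is_derive t 1 phi (dphi t)),
      (forall t : R, 0 <= t <= 1 -> `|dphi t| <= M) &
      forall t : R, is_derive t 1 dphi (2 * lam * phi t)].
Proof.
move=> l0; pose s := Num.sqrt (2 * lam).
have s0 : 0 < s by rewrite sqrtr_gt0 mulr_gt0.
have s2 : s * s = 2 * lam by rewrite -expr2 sqr_sqrtr// mulr_ge0// ltW.
pose D := expR s - expR (- s).
have D0 : 0 < D by rewrite subr_gt0 ltr_expR; lra.
pose phi t := (expR (s * t) - expR (- s * t)) / D.
pose dphi t := s * (expR (s * t) + expR (- s * t)) / D.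
have eD (p t : R) : is_derive t 1 (fun y => expR (p * y)) (expR (p * t) * p).
  have d : is_derive t 1 (fun y : R => p * y) (p * 1).
    by have := is_deriveZ p (is_derive_id t (1 : R)).
  have := @is_derive1_comp _ expR (fun y : R => p * y) t _ _ (is_derive_expR _) d.
  by rewrite mulr1.
have divD (f : R -> R) (t l : R) : is_derive t 1 f l ->
    is_derive t 1 (fun y => f y / D) (l / D).
  move=> fl; rewrite (_ : (fun y => _) = (D^-1 \*: f)); last first.
    by apply/funext => y /=; rewrite mulrC.
  by rewrite mulrC; exact: is_deriveZ.
exists phi, dphi, (s * (expR s + 1) / D); split.
- by rewrite /phi !mulr0 subrr mul0r.
- by rewrite /phi !mulr1 divff// gt_eqF.
- move=> t; rewrite /phi /dphi.
  rewrite (_ : s * _ = expR (s * t) * s - expR (- s * t) * - s); last by ring.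
  by apply: divD; exact: is_deriveB.
- move=> t /andP[t0 t1]; rewrite /dphi normrM normfV (gtr0_norm D0) ler_wpM2r ?invr_ge0 ?(ltW D0)//.
  rewrite normrM (gtr0_norm s0) ler_wpM2l ?(ltW s0)//.
  rewrite ger0_norm ?addr_ge0 ?expR_ge0// lerD//.
    by rewrite ler_expR; nra.
  by rewrite -[leRHS]expR0 ler_expR; nra.
- move=> t; rewrite /dphi /phi.
  rewrite (_ : 2 * lam * _ = (s * (expR (s * t) * s + expR (- s * t) * - s)) / D); last first.
    by rewrite -s2; ring.
  by apply: divD; apply: is_derive_scale; exact: is_deriveD.
Qed.

Definition sampled v := exists C : R, forall n,
  \sum_(0 <= k < n) (k%:R * v k) ^+ 2 <= C.

Lemma J_sampled u : bessel_dom u -> sampled (J u).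
Proof.
move=> du; exists (2 * dot (xfun u) (xfun u) + 2 * dot (xder u) (xder u)).
case=> [|n]; first by rewrite big_geq// addr_ge0// mulr_ge0// dot_ge0.
by rewrite big_ltn// mul0r expr0n add0r; exact: sum_sample_sqr_le.
Qed.

Definition harmonic_extension lam v w :=
  [/\ bessel_dom w, J w = v & forall z, kerJ z -> energy lam w z = 0].

Lemma harmonic_extension_exists lam v : 0 < lam -> sampled v -> exists w, harmonic_extension lam v w.
Proof.
move=> l0 sv; have [phi [dphi [M [phi0 phi1 phiD dphiM dphiD]]]] := hyperbolic_profile l0.
exists (interpolant phi v); split.
- exact: (@interpolant_dom _ phi dphi M).
- exact: J_interpolant.
- exact: (@interpolant_orthogonal _ phi dphi M lam v).
Qed.

Lemma ortho_lamP lam w : ortho_lam lam kerJ w <->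
  bessel_dom w /\ forall z, kerJ z -> energy lam w z = 0.
Proof.
split=> -[dw H]; split => // z kz; have dz : bessel_dom z by case: kz.
  by apply: EFin_inj; rewrite -(bessel_lamE _ dw dz) H.
by rewrite (bessel_lamE _ dw dz) H.
Qed.

(** P_lam is a choice among all functions with the properties of the projection. Two
    such functions p and w satisfy E(p, p) = E(u, p) = E(w, p) = E(u, w) = E(w, w), so the
    explicit w can be used in its place. *)
Lemma P_lam_energy lam u w : 0 < lam -> bessel_dom u -> harmonic_extension lam (J u) w ->
  bessel_lam lam (P_lam lam u) (P_lam lam u) = (energy lam w w)%:E.
Proof.
move=> l0 du [dw Jw ow].
pose S := [set w | ortho_lam lam kerJ w /\
  forall z, ortho_lam lam kerJ z -> bessel_lam lam (u \- w) z = 0%E].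
have Sw : S w.
  split; first exact/ortho_lamP.
  have duw : bessel_dom (u \- w) := bessel_dom_sub du dw.
  move=> z /ortho_lamP[dz oz]; rewrite (bessel_lamE _ duw dz) energyC oz//.
  by split => // k _ /=; rewrite -[w _]/(J w k) Jw subrr.
have SP : S (P_lam lam u) by apply: getPex; exists w.
set p := P_lam lam u in SP *.
have [/ortho_lamP[dp op] pu] := SP; have [_ wu] := Sw.
have Op : ortho_lam lam kerJ p by case: SP.
have Ow : ortho_lam lam kerJ w by case: Sw.
have key q z : bessel_dom q -> bessel_dom z -> bessel_lam lam (u \- q) z = 0%E ->
    energy lam q z = energy lam u z.
  move=> dq dz; rewrite (bessel_lamE _ (bessel_dom_sub du dq) dz).
  by rewrite energy_subl// => -[] /eqP; rewrite subr_eq0 => /eqP.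
rewrite (bessel_lamE _ dp dp); congr EFin.
rewrite (key p p dp dp (pu _ Op)) -(key w p dw dp (wu _ Op)) energyC.
by rewrite (key p w dp dw (pu _ Ow)) -(key w w dw dw (wu _ Ow)).
Qed.

Lemma harmonic_extension_minimal lam v w u : 0 < lam -> harmonic_extension lam v w ->
  bessel_dom u -> J u = v -> energy lam w w <= energy lam u u.
Proof.
move=> l0 [dw Jw ow] du Ju.
have duw : bessel_dom (u \- w) by exact: bessel_dom_sub.
have kuw : kerJ (u \- w).
  split => // k _; rewrite /= -[u _]/(J u k) -[w _]/(J w k) Ju Jw subrr//.
have e1 : energy lam u w = energy lam w w.
  by apply/eqP; rewrite -subr_eq0 -energy_subl// energyC ow.
have : 0 <= energy lam (u \- w) (u \- w) by apply: energy_ge0; exact: ltW.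
rewrite energy_subr// !energy_subl// (energyC lam w u) e1; lra.
Qed.

Variable a : nat -> R.

(** The domain does not depend on lam: the harmonic interpolant extends any admissible
    sequence. *)
Lemma ranJP v : ranJ a v <-> l2 a v /\ sampled v.
Proof.
split=> [[u [du l2u] <-]|[l2v sv]]; first by split => //; exact: J_sampled.
exists (harmonic_interpolant v); last exact: J_harmonic_interpolant.
split; first exact: harmonic_interpolant_dom.
by rewrite J_harmonic_interpolant.
Qed.

(** Any extension of v has energy at least Q v. The projection has least energy among
    all extensions, hence at most that of the harmonic interpolant, whose energy is
    Q v plus lam times a constant. *)
Lemma trace_lam_bounds v : ranJ a v -> exists2 C : R, 0 <= C &
  forall lam, 0 < lam ->
    (Q v <= trace_lam a lam v)%E /\ (trace_lam a lam v <= Q v + (lam * C)%:E)%E.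
Proof.
move=> rv; have [l2v sv] := (ranJP v).1 rv.
pose U := harmonic_interpolant v.
have dU : bessel_dom U := harmonic_interpolant_dom sv.
exists (2 * dot (xfun U) (xfun U)); first by rewrite mulr_ge0// dot_ge0.
move=> lam l0; rewrite /trace_lam mem_set//=.
set u := get _.
have [[du _] Ju] : domJ a u /\ J u = v.
  by apply: (@getPex _ [set u | domJ a u /\ J u = v]); have [u0 d0 j0] := rv; exists u0.
have [w hw] := harmonic_extension_exists l0 sv.
have hw' : harmonic_extension lam (J u) w by rewrite Ju.
rewrite (P_lam_energy l0 du hw'); have [dw Jw _] := hw; split.
  rewrite -Jw; apply: (le_trans (Q_le_energy dw)).
  by rewrite lee_fin /energy lerDl mulr_ge0 ?(ltW l0)// mulr_ge0// dot_ge0.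
rewrite -harmonic_energy// -EFinD lee_fin.
exact: (harmonic_extension_minimal l0 hw dU (J_harmonic_interpolant v)).
Qed.

Lemma trace_lam_notin lam v : ~ ranJ a v -> trace_lam a lam v = +oo%E.
Proof. by move=> nv; rewrite /trace_lam memNset. Qed.

Lemma ranJ_Q_fin v : ranJ a v -> Q v \is a fin_num.
Proof. by move=> /ranJP[_ sv]; rewrite -harmonic_energy. Qed.

End TraceBounds.

(** * The discrete form Q *)

Section Sequences.
Context {R : realType}.
Implicit Types (v x y : nat -> R) (f : nat -> R) (C D : R).

Lemma series_leP f C : (forall k, (0 < k)%N -> 0 <= f k) ->
  (\sum_(1 <= k <oo) (f k)%:E <= C%:E)%E <->
  forall n, \sum_(1 <= k < n) f k <= C.
Proof.
move=> f0; split => [H n|H].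
  rewrite -lee_fin -sumEFin; apply: le_trans H; apply: nneseries_lim_ge => k k1 _.
  by rewrite lee_fin f0.
apply: lime_le; last by apply: nearW => n; rewrite sumEFin lee_fin.
by apply: is_cvg_nneseries => k k1 _; rewrite lee_fin f0.
Qed.

Lemma series_ge0 f : (forall k, (0 < k)%N -> 0 <= f k) ->
  (0 <= \sum_(1 <= k <oo) (f k)%:E)%E.
Proof. by move=> f0; apply: nneseries_ge0 => k k1 _; rewrite lee_fin f0. Qed.

Lemma series_fineK f : (forall k, (0 < k)%N -> 0 <= f k) ->
  (\sum_(1 <= k <oo) (f k)%:E < +oo)%E ->
  (fine (\sum_(1 <= k <oo) (f k)%:E))%:E = (\sum_(1 <= k <oo) (f k)%:E)%E.
Proof. by move=> f0 foo; rewrite fineK// ge0_fin_numE// series_ge0. Qed.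

Lemma term_le_sum f k n : (forall k, (0 < k)%N -> 0 <= f k) -> (0 < k)%N -> (k < n)%N ->
  f k <= \sum_(1 <= j < n) f j.
Proof.
move=> f0 k0 kn; have sum_ge0 p q : (0 < p)%N -> 0 <= \sum_(p <= j < q) f j.
  move=> p0; rewrite big_nat; apply: sumr_ge0 => j /andP[pj _].
  by apply: f0; exact: leq_trans pj.
rewrite (big_cat_nat (n := k.+1))//= big_nat_recr//= addrAC lerDr.
by rewrite addr_ge0// sum_ge0.
Qed.

Lemma sum1_mono f n m : (forall k, (0 < k)%N -> 0 <= f k) -> (n <= m)%N ->
  \sum_(1 <= k < n) f k <= \sum_(1 <= k < m) f k.
Proof.
move=> f0 nm; have s0 p q : (0 < p)%N -> 0 <= \sum_(p <= k < q) f k.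
  move=> p0; rewrite big_nat; apply: sumr_ge0 => k /andP[pk _].
  by apply: f0; exact: leq_trans pk.
case: n nm => [|n] nm; first by rewrite [leLHS]big_geq// s0.
by rewrite [leRHS](big_cat_nat (n := n.+1))//= lerDl s0.
Qed.

Lemma cvg_sum1 (f : nat -> nat -> R) (l : nat -> R) m :
  (forall k, (0 < k)%N -> f j k @[j --> \oo] --> l k) ->
  \sum_(1 <= k < m) f j k @[j --> \oo] --> \sum_(1 <= k < m) l k.
Proof.
move=> fl; elim: m => [|[|m] ih].
- by rewrite big_geq//; under eq_fun do rewrite big_geq//; exact: cvg_cst.
- by rewrite big_geq//; under eq_fun do rewrite big_geq//; exact: cvg_cst.
rewrite big_nat_recr//=; under eq_fun do rewrite big_nat_recr//=.
by apply: cvgD; [exact: ih|exact: fl].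
Qed.

Lemma ecvg0P (u : nat -> \bar R) : (forall n, 0 <= u n)%E ->
  u @ \oo --> 0%E <-> forall e : R, 0 < e -> \forall n \near \oo, (u n <= e%:E)%E.
Proof.
move=> u0; split => [/fine_cvgP[ufin ucvg] e e0|H].
  move/cvgrPdist_le : ucvg => /(_ _ e0) ue; near=> n.
  have fn : u n \is a fin_num by near: n.
  rewrite -(fineK fn) lee_fin; apply: le_trans (ler_norm _) _.
  by rewrite -normrN -sub0r; near: n.
apply/fine_cvgP; split.
  have := H _ ltr01; apply: filterS => j h.
  by rewrite ge0_fin_numE//; exact: le_lt_trans h (ltry _).
apply/cvgrPdist_le => e e0; have := H _ e0; apply: filterS => j h.
rewrite sub0r normrN ger0_norm ?fine_ge0// -lee_fin fineK//.
by rewrite ge0_fin_numE//; exact: le_lt_trans h (ltry _).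
Unshelve. all: by end_near. Qed.

(** A small tail of the majorant bounds the tails of all g j, which leaves finitely many
    terms. *)
Lemma dominated_series_cvg0 f (g : nat -> nat -> R) :
  (forall j k, (0 < k)%N -> 0 <= g j k <= f k) ->
  (\sum_(1 <= k <oo) (f k)%:E < +oo)%E ->
  (forall k, (0 < k)%N -> g j k @[j --> \oo] --> (0 : R)) ->
  (\sum_(1 <= k <oo) (g j k)%:E)%E @[j --> \oo] --> 0%E.
Proof.
move=> gf foo g0.
have f0 k : (0 < k)%N -> 0 <= f k.
  by move=> k0; have /andP[h1 h2] := gf 0%N k k0; exact: le_trans h2.
have gge0 j k : (0 < k)%N -> 0 <= g j k by move=> k0; have /andP[] := gf j k k0.
pose S := fine (\sum_(1 <= k <oo) (f k)%:E)%E.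
have fS n : \sum_(1 <= k < n) f k <= S.
  by apply: (series_leP S f0).1; rewrite series_fineK.
apply/ecvg0P => [j|e e0]; first exact/series_ge0/gge0.
have e20 : 0 < e / 2 by rewrite divr_gt0.
have [N HN] : exists N, S - e / 2 < \sum_(1 <= k < N) f k.
  apply: contrapT => /forallNP H.
  have : (\sum_(1 <= k <oo) (f k)%:E <= (S - e / 2)%:E)%E.
    by apply/series_leP => // n; rewrite leNgt; apply/negP/H.
  by rewrite -series_fineK// lee_fin -/S; lra.
have cN : \sum_(1 <= k < N) g j k @[j --> \oo] --> (0 : R).
  by have := @cvg_sum1 g (fun=> 0) N g0; rewrite [X in _ --> X -> _]big1.
move/cvgrPdist_lt : cN => /(_ _ e20); apply: filterS => j.
rewrite sub0r normrN => /(le_lt_trans (ler_norm _)) gj.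
apply/series_leP => [|n]; first exact: gge0.
have [nN|Nn] := leqP n N.
  apply: (@le_trans _ _ (\sum_(1 <= k < N) g j k)); last by lra.
  exact: sum1_mono (gge0 j) nN.
have [N0|N0] := posnP N.
  move: HN; rewrite N0 [X in _ < X]big_geq// => HN.
  have : \sum_(1 <= k < n) g j k <= \sum_(1 <= k < n) f k.
    by rewrite big_nat [leRHS]big_nat; apply: ler_sum => k /andP[k1 _]; have /andP[] := gf j k k1.
  by have := fS n; lra.
rewrite (big_cat_nat (n := N))//=; last exact: ltnW.
have : \sum_(N <= k < n) g j k <= \sum_(N <= k < n) f k.
  rewrite big_nat [leRHS]big_nat; apply: ler_sum => k /andP[k1 _].
  by have /andP[] := gf j k (leq_trans N0 k1).
have := fS n; rewrite (big_cat_nat (n := N))//=; last exact: ltnW.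
lra.
Qed.

Definition q_term v k : R := k%:R * k.+1%:R * (v k.+1 - v k) ^+ 2.

Lemma q_term_ge0 v k : 0 <= q_term v k.
Proof. by rewrite mulr_ge0 ?sqr_ge0. Qed.

Lemma Q_leP v C : (Q v <= C%:E)%E <-> forall n, \sum_(1 <= k < n) q_term v k <= C.
Proof. by apply: series_leP => k _; exact: q_term_ge0. Qed.

Lemma Q_ge0 v : (0 <= Q v)%E.
Proof. by apply: (@series_ge0 (q_term v)) => k _; exact: q_term_ge0. Qed.

Lemma Q_fineK v : (Q v < +oo)%E -> (fine (Q v))%:E = Q v.
Proof. by move=> h; rewrite fineK// ge0_fin_numE// Q_ge0. Qed.

Lemma Q_le_combination (p r : R) v x y C D : 0 <= p -> 0 <= r ->
  (forall k, (0 < k)%N -> q_term v k <= p * q_term x k + r * q_term y k) ->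
  (Q x <= C%:E)%E -> (Q y <= D%:E)%E -> (Q v <= (p * C + r * D)%:E)%E.
Proof.
move=> p0 r0 H /Q_leP hx /Q_leP hy; apply/Q_leP => n.
apply: (@le_trans _ _ (\sum_(1 <= k < n) (p * q_term x k + r * q_term y k))).
  by rewrite big_nat [leRHS]big_nat; apply: ler_sum => k /andP[k1 _]; exact: H.
by rewrite big_split/= -!mulr_sumr lerD// ler_wpM2l.
Qed.

(** Young's inequality (s + d)^2 <= (1 + e) s^2 + (1 + 1/e) d^2 in each term. *)
Lemma Q_perturb (e : R) x y C D : 0 < e -> (Q y <= C%:E)%E ->
  (Q (x \- y)%R <= D%:E)%E -> (Q x <= ((1 + e) * C + (1 + e^-1) * D)%:E)%E.
Proof.
move=> e0; apply: Q_le_combination => [||k k0].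
- by rewrite addr_ge0// ltW.
- by rewrite addr_ge0// invr_ge0 ltW.
rewrite /q_term /=.
set p := k%:R * k.+1%:R; have p0 : 0 <= p by rewrite mulr_ge0.
rewrite ![_ * (p * _)]mulrCA -mulrDr ler_wpM2l//.
set s := y k.+1 - y k; set d := x k.+1 - x k - s.
have -> : x k.+1 - y k.+1 - (x k - y k) = d by rewrite /d /s; ring.
have -> : x k.+1 - x k = s + d by rewrite /d; ring.
have : 0 <= (e * s - d) ^+ 2 / e by rewrite divr_ge0 ?sqr_ge0// ltW.
rewrite (_ : _ / e = (1 + e) * s ^+ 2 + (1 + e^-1) * d ^+ 2 - (s + d) ^+ 2); last first.
  by field; rewrite gt_eqF.
by rewrite subr_ge0.
Qed.

Lemma Q_sub_le x y C D : (Q x <= C%:E)%E -> (Q y <= D%:E)%E ->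
  (Q (x \- y)%R <= (2 * C + 2 * D)%:E)%E.
Proof.
apply: Q_le_combination => // k _; rewrite /q_term/=.
set p := k%:R * k.+1%:R; have p0 : 0 <= p by rewrite mulr_ge0.
rewrite ![2 * (p * _)]mulrCA -mulrDr ler_wpM2l//.
have := sqr_ge0 ((x k.+1 - x k) + (y k.+1 - y k)); nra.
Qed.

Lemma double_le_add (p r s : R) : 0 <= r -> 0 <= s -> p ^+ 2 <= r * s -> 2 * p <= r + s.
Proof.
move=> r0 s0 h; rewrite leNgt; apply/negP => h2.
have := sqr_ge0 (r - s); nra.
Qed.

(** The Cauchy-Schwarz inequality with the weights 1/(k(k+1)), whose sum telescopes. *)
Lemma Q_oscillation v m n : (0 < m)%N -> (m <= n)%N ->
  (v n - v m) ^+ 2 <= (m%:R^-1 - n%:R^-1) * \sum_(m <= k < n) q_term v k.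
Proof.
move=> m0; elim: n => [|n ih]; first by rewrite leqn0 => /eqP m0'; rewrite m0' in m0.
rewrite leq_eqVlt => /predU1P[<-|mn]; first by rewrite !subrr expr0n mul0r.
have {}ih := ih mn; have n0 : (0 < n)%N := leq_trans m0 mn.
rewrite big_nat_recr//=.
set S := \sum_(_ <= _ < _) _ in ih *.
have S0 : 0 <= S by apply: sumr_ge0 => k _; exact: q_term_ge0.
have n0' : 0 < n%:R :> R by rewrite ltr0n.
have m0' : 0 < m%:R :> R by rewrite ltr0n.
set p := m%:R^-1 - n%:R^-1 in ih *.
have p0 : 0 <= p by rewrite subr_ge0 lef_pV2 ?posrE// ler_nat.
pose r : R := (n%:R * n.+1%:R)^-1.
have r0 : 0 <= r by rewrite invr_ge0 mulr_ge0.
have pr : m%:R^-1 - n.+1%:R^-1 = p + r.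
  rewrite /p /r -natr1; field.
  by rewrite natr1 pnatr_eq0 !gt_eqF.
have q0 := q_term_ge0 v n; set q := q_term v n in q0 *.
have Bq : (v n.+1 - v n) ^+ 2 = r * q.
  by rewrite /r /q /q_term mulrA mulVf ?mul1r// mulf_neq0 ?pnatr_eq0 ?gt_eqF.
rewrite pr (_ : v n.+1 - v m = (v n - v m) + (v n.+1 - v n)); last by ring.
set A := v n - v m in ih *; set B := v n.+1 - v n in Bq *.
have := @double_le_add (A * B) (p * q) (r * S) (mulr_ge0 p0 q0) (mulr_ge0 r0 S0).
rewrite exprMn Bq => h.
have h1 : A ^+ 2 * (r * q) <= p * q * (r * S).
  have -> : p * q * (r * S) = (p * S) * (r * q) by ring.
  by rewrite ler_wpM2r// mulr_ge0.
have := h h1; rewrite -/B; nra.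
Qed.

(** Sequences of finite energy that vanish at infinity decay like k^(-1/2), with a
    constant that is controlled by the energy. *)
Lemma cvg0_decay v C : v @ \oo --> (0 : R) -> (Q v <= C%:E)%E ->
  forall k, (0 < k)%N -> k%:R * v k ^+ 2 <= C.
Proof.
move=> v0 /Q_leP QC k k0; have k0' : 0 < k%:R :> R by rewrite ltr0n.
rewrite -ler_pdivlMl//.
have cv : (v n - v k) ^+ 2 @[n --> \oo] --> (v k ^+ 2 : R).
  have -> : v k ^+ 2 = (0 - v k) * (0 - v k) by ring.
  by under eq_fun do rewrite expr2; apply: cvgM; apply: cvgB => //; exact: cvg_cst.
rewrite -(cvg_lim _ cv)//; apply: limr_le; first by apply/cvg_ex; exists (v k ^+ 2).
near=> n; have kn : (k <= n)%N by near: n; exact: nbhs_infty_ge.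
apply: (le_trans (Q_oscillation v k0 kn)); apply: ler_pM.
- by rewrite subr_ge0 lef_pV2 ?posrE ?ler_nat// ltr0n (leq_trans k0).
- by apply: sumr_ge0 => j _; exact: q_term_ge0.
- by rewrite gerBl.
- apply: le_trans (QC n); rewrite [leRHS](big_cat_nat (n := k))//= lerDr.
  by apply: sumr_ge0 => j _; exact: q_term_ge0.
Unshelve. all: by end_near. Qed.

Lemma decay_cvg0 v C : (forall k, (0 < k)%N -> k%:R * v k ^+ 2 <= C) ->
  v @ \oo --> (0 : R).
Proof.
move=> H; apply/cvgrPdist_lt => e e0; near=> n.
have n0 : (0 < n)%N by near: n; exact: nbhs_infty_gt.
have n0' : 0 < n%:R :> R by rewrite ltr0n.
have nC : C / e ^+ 2 < n%:R by near: n; exact: nbhs_infty_gtr.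
rewrite sub0r normrN -(@ltr_pXn2r _ 2)// ?nnegrE ?(ltW e0)// sqr_normr.
rewrite -(ltr_pM2l n0'); apply: le_lt_trans (H _ n0) _.
by rewrite -ltr_pdivrMr// exprn_gt0.
Unshelve. all: by end_near. Qed.

Lemma sampled_cvg0 v : sampled v -> v @ \oo --> (0 : R).
Proof.
move=> [C HC]; apply: (@decay_cvg0 _ C) => k k0.
have k1 : 1 <= k%:R :> R by rewrite ler1n.
apply: (@le_trans _ _ ((k%:R * v k) ^+ 2)).
  by rewrite exprMn expr2 ler_wpM2r ?sqr_ge0// ler_peMl.
apply: le_trans (HC k.+1); rewrite big_nat_recr//= lerDr.
by apply: sumr_ge0 => j _; exact: sqr_ge0.
Qed.

Lemma frequently_le_cvg (f : nat -> R) l C : f @ \oo --> l ->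
  (forall N, exists2 n, (N <= n)%N & f n <= C) -> l <= C.
Proof.
move=> fl fC; rewrite leNgt; apply/negP => Cl.
have [N _ HN] : \forall n \near \oo, C < f n by apply: cvgr_gt fl _ Cl.
by have [n Nn] := fC N; rewrite leNgt (HN _ Nn).
Qed.

(** Vanishing at infinity is preserved by pointwise limits with bounded Q, because it
    follows from the decay estimate, which passes to the limit index by index. *)
Lemma Q_lower_semicontinuous (vn : nat -> (nat -> R)) v C :
  (forall k, (0 < k)%N -> vn n k @[n --> \oo] --> v k) ->
  (forall N, exists2 n, (N <= n)%N & (Q (vn n) <= C%:E)%E /\ vn n @ \oo --> (0 : R)) ->
  (Q v <= C%:E)%E /\ v @ \oo --> (0 : R).
Proof.
move=> pw fr; split.
  apply/Q_leP => m; apply: (@frequently_le_cvg (fun n => \sum_(1 <= k < m) q_term (vn n) k)).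
    apply: (@cvg_sum1 (fun n k => q_term (vn n) k) (q_term v)) => k k0.
    rewrite /q_term; apply: cvgM; first exact: cvg_cst.
    rewrite expr2; under eq_fun do rewrite expr2.
    by apply: cvgM; apply: cvgB; apply: pw.
  by move=> N; have [n Nn [/Q_leP h _]] := fr N; exists n.
apply: (@decay_cvg0 _ C) => k k0.
apply: (@frequently_le_cvg (fun n => k%:R * vn n k ^+ 2)).
  apply: cvgM; first exact: cvg_cst.
  by rewrite expr2; under eq_fun do rewrite expr2; apply: cvgM; exact: pw.
by move=> N; have [n Nn [h1 h2]] := fr N; exists n => //; exact: cvg0_decay.
Qed.

End Sequences.

(** * Convergence in the weighted sequence space *)

Section WeightedL2.
Context {R : realType}.
Variable a : nat -> R.
Hypothesis a_gt0 : forall k : nat, (0 < k)%N -> 0 < a k.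
Implicit Types (v w x y : nat -> R) (e : R) (vn : nat -> nat -> R).

Let a_ge0 k : (0 < k)%N -> 0 <= a k. Proof. by move=> /a_gt0/ltW. Qed.

Definition l2_term v k : R := a k * v k ^+ 2.

Let l2_term_ge0 v k : (0 < k)%N -> 0 <= l2_term v k.
Proof. by move=> k0; rewrite mulr_ge0 ?sqr_ge0 ?a_ge0. Qed.

Lemma l2_leP v (C : R) :
  (l2_norm2 a v <= C%:E)%E <-> forall n, \sum_(1 <= k < n) l2_term v k <= C.
Proof. exact: series_leP (l2_term_ge0 v). Qed.

Lemma l2_norm2_ge0 v : (0 <= l2_norm2 a v)%E.
Proof. exact: series_ge0 (l2_term_ge0 v). Qed.

Lemma l2_fineK v : l2 a v -> (fine (l2_norm2 a v))%:E = l2_norm2 a v.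
Proof. exact: series_fineK (l2_term_ge0 v). Qed.

Lemma l2_dominated v w : (forall k, (0 < k)%N -> w k ^+ 2 <= v k ^+ 2) ->
  l2 a v -> l2 a w.
Proof.
move=> H l2v; apply: le_lt_trans (ltry (fine (l2_norm2 a v))); apply/l2_leP => n.
have /l2_leP/(_ n) : (l2_norm2 a v <= (fine (l2_norm2 a v))%:E)%E by rewrite l2_fineK.
apply: le_trans; rewrite big_nat [leRHS]big_nat; apply: ler_sum => k /andP[k0 _].
by rewrite ler_wpM2l ?H// a_ge0.
Qed.

Lemma l2_sub v w : l2 a v -> l2 a w -> l2 a (v \- w).
Proof.
move=> l2v l2w.
have /l2_leP hv : (l2_norm2 a v <= (fine (l2_norm2 a v))%:E)%E by rewrite l2_fineK.
have /l2_leP hw : (l2_norm2 a w <= (fine (l2_norm2 a w))%:E)%E by rewrite l2_fineK.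
apply: le_lt_trans (ltry (2 * fine (l2_norm2 a v) + 2 * fine (l2_norm2 a w))).
apply/l2_leP => n.
apply: (@le_trans _ _ (\sum_(1 <= k < n) (2 * l2_term v k + 2 * l2_term w k))).
  rewrite big_nat [leRHS]big_nat; apply: ler_sum => k /andP[k0 _].
  rewrite /l2_term /= ![2 * (a k * _)]mulrCA -mulrDr ler_wpM2l ?a_ge0//.
  by have := sqr_ge0 (v k + w k); nra.
by rewrite big_split/= -!mulr_sumr lerD// ler_wpM2l.
Qed.

Lemma strong_cvg_pointwise vn v k : strong_cvg a vn v -> (0 < k)%N ->
  vn n k @[n --> \oo] --> v k.
Proof.
move=> [_ _ /ecvg0P-/(_ (fun n => l2_norm2_ge0 _)) H] k0.
apply/cvgrPdist_le => e e0.
have ak := a_gt0 k0.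
have ae0 : 0 < a k * e ^+ 2 by rewrite mulr_gt0// exprn_gt0.
have := H _ ae0; apply: filterS => n /l2_leP/(_ k.+1) h.
have := le_trans (term_le_sum (l2_term_ge0 (vn n \- v)) k0 (ltnSn k)) h.
rewrite /l2_term /= ler_pM2l// => h2.
by rewrite distrC -(@ler_pXn2r _ 2)// ?nnegrE ?(ltW e0)// sqr_normr.
Qed.

Let pairing v w k : R := a k * v k * w k.

Let pairing_le e x y k : 0 < e -> (0 < k)%N ->
  `|pairing x y k| <= e * l2_term y k + e^-1 * l2_term x k.
Proof.
move=> e0 k0; rewrite /pairing /l2_term -mulrA normrM (ger0_norm (a_ge0 k0)).
rewrite ![_ * (a k * _)]mulrCA -mulrDr ler_wpM2l ?a_ge0//.
have ei : 0 <= e^-1 by rewrite invr_ge0 ltW.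
have e1 : e * e^-1 = 1 by rewrite divff// gt_eqF.
have sq1 : 0 <= (e * y k - x k) ^+ 2 * e^-1 by rewrite mulr_ge0// sqr_ge0.
have sq2 : 0 <= (e * y k + x k) ^+ 2 * e^-1 by rewrite mulr_ge0// sqr_ge0.
have E1 : (e * y k - x k) ^+ 2 * e^-1 = e * y k ^+ 2 + e^-1 * x k ^+ 2 - 2 * (x k * y k).
  by field; rewrite gt_eqF.
have E2 : (e * y k + x k) ^+ 2 * e^-1 = e * y k ^+ 2 + e^-1 * x k ^+ 2 + 2 * (x k * y k).
  by field; rewrite gt_eqF.
have p1 : 0 <= e * y k ^+ 2 + e^-1 * x k ^+ 2.
  by rewrite addr_ge0// mulr_ge0 ?sqr_ge0// ltW.
rewrite ler_norml; apply/andP; split; lra.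
Qed.

Let sum_pairing_le e x y (C D : R) n : 0 < e -> (l2_norm2 a x <= C%:E)%E ->
  (l2_norm2 a y <= D%:E)%E ->
  \sum_(1 <= k < n) `|pairing x y k| <= e * D + e^-1 * C.
Proof.
move=> e0 /l2_leP hx /l2_leP hy.
apply: (@le_trans _ _ (\sum_(1 <= k < n) (e * l2_term y k + e^-1 * l2_term x k))).
  rewrite big_nat [leRHS]big_nat; apply: ler_sum => k /andP[k0 _].
  exact: pairing_le.
by rewrite big_split/= -!mulr_sumr lerD// ler_wpM2l ?invr_ge0// ltW.
Qed.

Lemma l2_ip_cvg v w : l2 a v -> l2 a w ->
  \sum_(1 <= k < n) a k * v k * w k @[n --> \oo] --> l2_ip a v w.
Proof.
move=> l2v l2w; suff : cvgn (fun n => \sum_(1 <= k < n) pairing v w k) by [].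
rewrite (is_cvg_series_restrict 1 (pairing v w)).
apply: normed_cvg; apply: nondecreasing_is_cvgn.
  by apply: nondecreasing_series => k _ _; exact: normr_ge0.
pose C := fine (l2_norm2 a v); pose D := fine (l2_norm2 a w).
exists (`|pairing v w 0| + (1 * D + 1^-1 * C)) => _ [n _ <-] /=.
rewrite /series/=; case: n => [|n].
  rewrite big_geq// addr_ge0// mul1r invr1 mul1r addr_ge0//; apply: fine_ge0;
  exact: l2_norm2_ge0.
rewrite big_ltn// lerD2l; apply: sum_pairing_le => //.
  by rewrite l2_fineK.
by rewrite l2_fineK.
Qed.

(** The pairing with w of a sequence of small norm is at most h |w|^2 plus 1/h times its
    squared norm; h is chosen first. *)
Lemma strong_cvg_weak vn v : strong_cvg a vn v -> weak_cvg a vn v.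
Proof.
move=> [l2n l2v /ecvg0P-/(_ (fun n => l2_norm2_ge0 _)) H]; split => // w l2w.
pose D := fine (l2_norm2 a w).
have D0 : 0 <= D by apply: fine_ge0; exact: l2_norm2_ge0.
apply/cvgrPdist_le => e e0.
pose h := e / (2 * (D + 1)).
have h0 : 0 < h by rewrite divr_gt0// mulr_gt0// ltr_wpDl.
have hD : h * D <= e / 2.
  rewrite /h mulrAC ler_pdivrMr ?mulr_gt0 ?ltr_wpDl//.
  by rewrite (_ : e / 2 * (2 * (D + 1)) = e * (D + 1)); [rewrite ler_pM2l//; lra|field].
have he0 : 0 < h * (e / 2) by rewrite mulr_gt0// divr_gt0.
have := H _ he0; apply: filterS => n hn.
have cv : `|\sum_(1 <= k < m) a k * v k * w k - \sum_(1 <= k < m) a k * vn n k * w k|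
    @[m --> \oo] --> `|l2_ip a v w - l2_ip a (vn n) w|.
  exact: (cvg_norm (cvgB (l2_ip_cvg l2v l2w) (l2_ip_cvg (l2n n) l2w))).
rewrite -(cvg_lim _ cv)//; apply: limr_le; first by apply/cvg_ex; eexists; exact: cv.
apply: nearW => m; rewrite distrC -sumrB.
apply: (le_trans (ler_norm_sum _ _ _)).
rewrite (eq_bigr (fun k => `|pairing (vn n \- v) w k|)); last first.
  by move=> k _; rewrite /pairing/=; congr `|_|; ring.
apply: (le_trans (sum_pairing_le m h0 hn (_ : (_ <= D%:E)%E))).
  by rewrite l2_fineK.
rewrite mulKf ?gt_eqF//; lra.
Qed.

Let indicator_l2 k : l2 a (fun j => (j == k)%:R).
Proof.
apply: le_lt_trans (ltry `|a k|); apply/l2_leP => n.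
rewrite /l2_term; have [kn|kn] := boolP (k \in index_iota 1 n); last first.
  rewrite big_seq big1 ?normr_ge0// => j jn.
  have -> : (j == k) = false by apply: contraNF kn => /eqP <-.
  by rewrite expr0n/= mulr0.
rewrite (big_rem k)//= eqxx expr1n mulr1 big_seq big1 ?addr0 ?ler_norm// => j.
rewrite mem_rem_uniq ?iota_uniq// inE => /andP[/negbTE -> _].
by rewrite expr0n/= mulr0.
Qed.

Lemma weak_cvg_pointwise vn v k : weak_cvg a vn v -> (0 < k)%N ->
  vn n k @[n --> \oo] --> v k.
Proof.
move=> [_ _ /(_ _ (indicator_l2 k)) H] k0.
have ipE x : l2_ip a x (fun j => (j == k)%:R) = a k * x k.
  apply/cvg_lim => //; apply: cvg_near_cst; near=> n.
  have kn : (k < n)%N by near: n; exact: nbhs_infty_gt.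
  rewrite (big_rem k)/=; last by rewrite mem_index_iota k0.
  rewrite eqxx mulr1 big_seq big1 ?addr0// => j.
  rewrite mem_rem_uniq ?iota_uniq// inE => /andP[/negbTE -> _].
  by rewrite mulr0.
move: H; rewrite ipE; under eq_fun do rewrite ipE.
have ak : a k != 0 by rewrite gt_eqF// a_gt0.
move=> h; have : (a k)^-1 * (a k * vn n k) @[n --> \oo] --> (a k)^-1 * (a k * v k).
  exact: cvgMr.
rewrite mulKf//; apply: cvg_trans; apply: near_eq_cvg; apply: nearW => n.
by rewrite /= mulKf.
Unshelve. all: by end_near. Qed.

End WeightedL2.

(** * Approximation by finitely supported sequences *)

Section SoftThreshold.
Context {R : realType}.
Implicit Types (v : nat -> R) (e s t : R).

Lemma clamp_contraction e s t :
  (clamp (- e) e s - clamp (- e) e t) ^+ 2 <= (s - t) ^+ 2 /\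
  ((s - clamp (- e) e s) - (t - clamp (- e) e t)) ^+ 2 <= (s - t) ^+ 2.
Proof.
wlog st : s t / t <= s => [H|].
  have [/H//|/ltW/H[h1 h2]] := leP t s.
  split; [move: h1|move: h2]; congr (_ <= _); ring.
have := clamp_homo (- e) e st; have := clamp_dist (- e) e st.
set x := clamp _ _ s; set y := clamp _ _ t => h1 h2.
split; rewrite ler_pXn2r ?nnegrE//; lra.
Qed.

Lemma clamp_sqr_le e s : 0 <= e ->
  clamp (- e) e s ^+ 2 <= s ^+ 2 /\ (s - clamp (- e) e s) ^+ 2 <= s ^+ 2.
Proof.
move=> e0; have := clamp_contraction e s 0.
by rewrite (@clamp_id _ (- e) e 0) ?oppr_le0 ?e0// !subr0.
Qed.

(** Soft thresholding at level e is a normal contraction, so it increases neither Q nor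
    the norm, and it turns a sequence tending to 0 into a finitely supported one. What it
    removes is the truncation at level e, again a normal contraction, which tends to 0
    with e by dominated convergence. *)
Definition soft e v : nat -> R := fun k => v k - clamp (- e) e (v k).

Definition truncation e v : nat -> R := fun k => clamp (- e) e (v k).

Lemma soft_sub e v : soft e v \- v = (fun k => - truncation e v k).
Proof. by apply/funext => k; rewrite /soft /truncation /= addrAC subrr add0r. Qed.

Lemma soft_q_term e v k : q_term (soft e v) k <= q_term v k.
Proof.
by rewrite ler_wpM2l ?mulr_ge0//; exact: (clamp_contraction e (v k.+1) (v k)).2.
Qed.

Lemma truncation_q_term e v k : q_term (fun k => - truncation e v k) k <= q_term v k.
Proof.
rewrite ler_wpM2l ?mulr_ge0// -opprD sqrrN.
exact: (clamp_contraction e (v k.+1) (v k)).1.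
Qed.

Lemma soft_Q_le e v (C : R) : (Q v <= C%:E)%E -> (Q (soft e v) <= C%:E)%E.
Proof.
move=> /Q_leP H; apply/Q_leP => n; apply: le_trans (H n).
by apply: ler_sum => k _; exact: soft_q_term.
Qed.

Lemma soft_sampled e v : 0 < e -> v @ \oo --> (0 : R) -> sampled (soft e v).
Proof.
move=> e0 /cvgrPdist_le/(_ _ e0)[N _ HN].
exists (\sum_(0 <= k < N) (k%:R * soft e v k) ^+ 2) => n.
have s0 p q : 0 <= \sum_(p <= k < q) (k%:R * soft e v k) ^+ 2.
  by apply: sumr_ge0 => k _; exact: sqr_ge0.
have [nN|Nn] := leqP n N; first by rewrite [leRHS](big_cat_nat (n := n))//= lerDl.
rewrite (big_cat_nat (n := N))//=; last exact: ltnW.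
rewrite [X in _ + X]big_nat [X in _ + X]big1 ?addr0// => k /andP[Nk _].
have := HN k Nk; rewrite /= sub0r normrN ler_norml => vk.
by rewrite /soft clamp_id// subrr mulr0 expr0n.
Qed.

Definition approx v (j : nat) : nat -> R := soft j.+1%:R^-1 v.

Lemma truncation_cvg0 v k : - truncation j.+1%:R^-1 v k @[j --> \oo] --> (0 : R).
Proof.
have h : j.+1%:R^-1 @[j --> \oo] --> (0 : R) by exact: cvg_harmonic.
rewrite -oppr0; apply: cvgN.
apply: (@squeeze_cvgr _ _ _ _ (fun j => - j.+1%:R^-1) (fun j => j.+1%:R^-1)) => //.
  apply: nearW => j; apply: clamp_bounds.
  by rewrite (@le_trans _ _ 0)// oppr_le0.
by rewrite -oppr0; exact: cvgN.
Qed.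

Lemma approx_Q_cvg v : (Q v < +oo)%E -> Q (approx v j \- v) @[j --> \oo] --> 0%E.
Proof.
move=> Qv; under eq_fun do rewrite /approx soft_sub.
apply: (@dominated_series_cvg0 _ (q_term v)
  (fun j => q_term (fun k => - truncation j.+1%:R^-1 v k))) => //.
  by move=> j k _; rewrite q_term_ge0 truncation_q_term.
move=> k k0; rewrite /q_term.
rewrite -[X in _ --> X](mulr0 (k%:R * k.+1%:R)); apply: cvgMr.
rewrite (_ : 0 = (0 - 0) * (0 - 0) :> R); last by rewrite subrr mul0r.
by under eq_fun do rewrite expr2; apply: cvgM; apply: cvgB; exact: truncation_cvg0.
Qed.

Variable a : nat -> R.
Hypothesis a_gt0 : forall k : nat, (0 < k)%N -> 0 < a k.

Lemma approx_strong_cvg v : l2 a v -> strong_cvg a (approx v) v.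
Proof.
move=> l2v; split => //.
  move=> j; apply: (l2_dominated a_gt0 _ l2v) => k _.
  by apply: (clamp_sqr_le _ _).2.
under eq_fun do rewrite /approx soft_sub.
apply: (@dominated_series_cvg0 _ (l2_term a v)
  (fun j => l2_term a (fun k => - truncation j.+1%:R^-1 v k))) => //.
  move=> j k k0; have ak := a_gt0 k0; rewrite mulr_ge0 ?sqr_ge0 ?(ltW ak)//=.
  by rewrite ler_pM2l// sqrrN; apply: (clamp_sqr_le _ _).1.
move=> k k0; rewrite /l2_term -[X in _ --> X](mulr0 (a k)); apply: cvgMr.
rewrite (_ : 0 = 0 * 0 :> R); last by rewrite mul0r.
by under eq_fun do rewrite expr2; apply: cvgM; exact: truncation_cvg0.
Qed.

Lemma approx_ranJ v j : l2 a v -> v @ \oo --> (0 : R) -> ranJ a (approx v j).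
Proof.
move=> l2v v0; apply/ranJP; split; last exact: soft_sampled.
by have [] := approx_strong_cvg l2v.
Qed.

End SoftThreshold.

(** * The Mosco limit and its domain *)

Section EReal.
Context {R : realType}.
Implicit Types (u : nat -> \bar R) (c l e : R).

Lemma limn_einf_lt_frequently u c : (limn_einf u < c%:E)%E ->
  forall N, exists2 n, (N <= n)%N & (u n < c%:E)%E.
Proof.
rewrite limn_einf_lim => uc N.
have : (einfs u N < c%:E)%E.
  apply: le_lt_trans uc; apply: lime_ge; first exact: is_cvg_einfs.
  by near=> n; apply: nondecreasing_einfs; near: n; exact: nbhs_infty_ge.
by move=> /ereal_inf_lt[_ [n /= Nn <-] h]; exists n.
Unshelve. all: by end_near. Qed.

Lemma limn_esup_le u l : (forall e, 0 < e -> \forall n \near \oo, (u n <= (l + e)%:E)%E) ->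
  (limn_esup u <= l%:E)%E.
Proof.
move=> H; apply/lee_addgt0Pr => e e0; rewrite limn_esup_lim.
apply: lime_le; first exact: is_cvg_esups.
have [N _ HN] := H _ e0; near=> n.
apply: ge_ereal_sup => _ [m /= nm <-]; rewrite -EFinD; apply: HN => /=.
apply: leq_trans nm; near: n; exact: nbhs_infty_ge.
Unshelve. all: by end_near. Qed.

Lemma le_of_real_bounds (x y : \bar R) : (0 <= x)%E ->
  (forall c : R, (y < c%:E)%E -> (x <= c%:E)%E) -> (x <= y)%E.
Proof.
case: y => [r| |] x0 H; last 2 first.
- exact: leey.
- have h : (x <= (-1 : R)%:E)%E by apply: H; exact: ltNyr.
  by have := le_trans x0 h; rewrite lee_fin oppr_ge0 ler10.
apply/lee_addgt0Pr => e e0; by rewrite -EFinD; apply: H; rewrite lte_fin ltrDl.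
Qed.

End EReal.

Section LimitForm.
Context {R : realType}.
Variable a : nat -> R.
Hypothesis a_gt0 : forall k : nat, (0 < k)%N -> 0 < a k.
Implicit Types (v w : nat -> R) (vn : nat -> nat -> R) (lam : nat -> R).

Let regular v := [/\ l2 a v, (Q v < +oo)%E & v @ \oo --> (0 : R)].

(** The trace form. Vanishing at infinity excludes the constants, which have zero energy
    and are square summable if the measure is finite. *)
Definition limit_form v : \bar R := if `[< regular v >] then Q v else +oo%E.

Let limit_formE v : regular v -> limit_form v = Q v.
Proof. by move=> rv; rewrite /limit_form asboolT. Qed.

Lemma limit_formP v : form_dom limit_form v <->
  [/\ l2 a v, (Q v < +oo)%E & v @ \oo --> (0 : R)].
Proof.
rewrite /form_dom /= /limit_form; split=> [|rv].
  by case: asboolP => // _; rewrite ltxx.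
by rewrite asboolT//; case: rv.
Qed.

Let limit_form_ge0 v : (0 <= limit_form v)%E.
Proof. by rewrite /limit_form; case: asboolP => // _; exact: Q_ge0. Qed.

Let ranJ_cvg0 v : ranJ a v -> v @ \oo --> (0 : R).
Proof. by move=> /ranJP[_]; exact: sampled_cvg0. Qed.

(** Traces vanish at infinity, so bounded energy along a subsequence of traces puts a
    pointwise limit into the domain. *)
Let limit_form_le vn v (C : R) : l2 a v ->
  (forall k, (0 < k)%N -> vn n k @[n --> \oo] --> v k) ->
  (forall N, exists2 n, (N <= n)%N & ranJ a (vn n) /\ (Q (vn n) <= C%:E)%E) ->
  (limit_form v <= C%:E)%E.
Proof.
move=> l2v pw H; have [|QC v0] := Q_lower_semicontinuous pw (C := C).
  by move=> N; have [n Nn [rn Qn]] := H N; exists n => //; split => //; exact: ranJ_cvg0.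
by rewrite limit_formE//; split => //; exact: le_lt_trans QC (ltry _).
Qed.

(** The trace forms are bounded below by Q, and weak convergence is pointwise. *)
Let mosco_liminf lam vn v : (forall n, 0 < lam n) -> weak_cvg a vn v ->
  (limit_form v <= limn_einf (fun n => trace_lam a (lam n) (vn n)))%E.
Proof.
move=> l0 wc; have [_ l2v _] := wc.
apply: le_of_real_bounds => // c /limn_einf_lt_frequently H.
apply: (@limit_form_le vn) => //; first by move=> k k0; exact: weak_cvg_pointwise wc k0.
move=> N; have [n Nn h] := H N; exists n => //.
have rn : ranJ a (vn n).
  by apply: contrapT => /trace_lam_notin E; move: h; rewrite E.
split => //; have [C _ HC] := trace_lam_bounds rn.
by have [h1 _] := HC _ (l0 n); exact: le_trans h1 (ltW h).
Qed.

(** For each approximant the trace form with parameter lam n exceeds Q by at most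
    lam n * C j. Taking at stage n the approximant of index at most n for which the
    squared distance to v plus this excess is least makes both tend to 0. *)
Let mosco_recovery lam v : (forall n, 0 < lam n) -> lam @ \oo --> (0 : R) -> l2 a v ->
  exists2 vn, strong_cvg a vn v &
    (limn_esup (fun n => trace_lam a (lam n) (vn n)) <= limit_form v)%E.
Proof.
move=> l0 lcvg l2v.
have [rv|nrv] := pselect (regular v); last first.
  exists (fun=> v); last by rewrite /limit_form asboolF// leey.
  split => //; have -> : (fun n : nat => l2_norm2 a (v \- v)) = (fun=> 0%E).
    apply/funext => n; apply: eseries0 => k _ _ /=.
    by rewrite subrr expr0n mulr0.
  exact: cvg_cst.
have [_ Qv v0] := rv; rewrite limit_formE//.
have rj j : ranJ a (approx v j) by exact: approx_ranJ.
have /choice[C HC] : forall j, exists C : R, 0 <= C /\ forall l, 0 < l ->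
    (trace_lam a l (approx v j) <= Q (approx v j) + (l * C)%:E)%E.
  by move=> j; have [C C0 h] := trace_lam_bounds (rj j); exists C; split => // l /h[].
have [l2j _ dcvg] := approx_strong_cvg a_gt0 l2v.
have l2d j : l2 a (approx v j \- v) by apply: l2_sub.
pose del j := fine (l2_norm2 a (approx v j \- v)).
have delE j : (del j)%:E = l2_norm2 a (approx v j \- v) by exact: l2_fineK.
have del0 j : 0 <= del j by apply: fine_ge0; exact: l2_norm2_ge0.
pose cost n j := del j + lam n * C j.
have excess0 n j : 0 <= lam n * C j by rewrite mulr_ge0 ?(HC j).1// ltW.
pose J_ n := [arg min_(i < (ord0 : 'I_n.+1)) cost n i]%O.
have J_min n j : (j <= n)%N -> cost n (J_ n) <= cost n j.
  move=> jn; rewrite /J_; case: arg_minP => // i _ H.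
  exact: (H (Ordinal (jn : (j < n.+1)%N)) isT).
have cost_small e : 0 < e -> \forall n \near \oo, cost n (J_ n) <= e.
  move=> e0; have e20 : 0 < e / 2 by rewrite divr_gt0.
  have [j hj] : exists j, del j <= e / 2.
    move/(ecvg0P (fun n => l2_norm2_ge0 a_gt0 _)) : dcvg => /(_ _ e20)[j _ hj].
    by exists j; rewrite -lee_fin delE; exact: (hj j (leqnn j)).
  have : lam n * C j @[n --> \oo] --> (0 : R).
    by rewrite -(mul0r (C j)); apply: cvgM => //; exact: cvg_cst.
  move/cvgrPdist_le => /(_ _ e20) hl; near=> n.
  have jn : (j <= n)%N by near: n; exact: nbhs_infty_ge.
  apply: (le_trans (J_min n j jn)); rewrite /cost.
  suff : lam n * C j <= e / 2 by lra.
  rewrite -(ger0_norm (excess0 n j)) -normrN -sub0r; near: n; exact: hl.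
exists (fun n => approx v (J_ n)).
  split => //; apply/ecvg0P => [n|e e0]; first exact: l2_norm2_ge0.
  have := cost_small _ e0; apply: filterS => n h.
  by rewrite -delE lee_fin; apply: le_trans h; rewrite lerDl.
rewrite -Q_fineK//; apply: limn_esup_le => e e0.
have := cost_small _ e0; apply: filterS => n h.
have [_ /(_ _ (l0 n)) h1] := HC (J_ n); apply: (le_trans h1); rewrite EFinD.
apply: leeD.
  by apply: soft_Q_le; rewrite Q_fineK.
by rewrite lee_fin; apply: le_trans h; rewrite lerDr.
Unshelve. all: by end_near. Qed.

Lemma limit_form_mosco : is_mosco_limit0 a (trace_lam a) limit_form.
Proof.
split=> [lam l0 lcvg|v nv]; last by rewrite /limit_form asboolF// => -[].
split=> [vn v|v]; first exact: mosco_liminf.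
exact: mosco_recovery.
Qed.

(** A recovery sequence for one limit is a competitor in the lower bound for the other. *)
Lemma mosco_limit_unique q r : is_mosco_limit0 a (trace_lam a) q ->
  is_mosco_limit0 a (trace_lam a) r -> q = r.
Proof.
move=> [qm qn] [rm rn]; apply/funext => v.
have [l2v|nv] := pselect (l2 a v); last by rewrite qn// rn.
have lam0 n : 0 < n.+1%:R^-1 :> R by rewrite invr_gt0.
have [qi qs] := qm _ lam0 cvg_harmonic; have [ri rs] := rm _ lam0 cvg_harmonic.
have one_side (f g : (nat -> R) -> \bar R) :
    (forall vn v, weak_cvg a vn v ->
      (f v <= limn_einf (fun n => trace_lam a n.+1%:R^-1 (vn n)))%E) ->
    (forall v, l2 a v -> exists2 vn, strong_cvg a vn v &
      (limn_esup (fun n => trace_lam a n.+1%:R^-1 (vn n)) <= g v)%E) ->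
    (f v <= g v)%E.
  move=> fi gs; have [vn sv gv] := gs v l2v.
  apply: le_trans gv; apply: le_trans (limn_einf_sup _).
  by apply: fi; exact: strong_cvg_weak.
by apply/eqP; rewrite eq_le (one_side q r)// (one_side r q).
Qed.

Lemma trace_formE : trace_form a = limit_form.
Proof.
apply: mosco_limit_unique limit_form_mosco.
by apply: getPex; exists limit_form; exact: limit_form_mosco.
Qed.

Let ranJ_sub v w : ranJ a v -> ranJ a w -> ranJ a (v \- w).
Proof.
move=> [u [du l2u] <-] [u' [du' l2u'] <-]; exists (u \- u'); last by [].
by split; [exact: bessel_dom_sub|exact: l2_sub].
Qed.

Let restrictE v : ranJ a v -> form_restrict (ranJ a) Q v = Q v.
Proof. by move=> rv; rewrite /form_restrict mem_set. Qed.

Let restrict_lty v (x : \bar R) : (form_restrict (ranJ a) Q v < x)%E -> ranJ a v.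
Proof.
rewrite /form_restrict; case: ifPn => [|_]; first by rewrite inE.
by rewrite ltNge leey.
Qed.

(** The Cauchy property bounds Q (vn n - vn m), and Q is lower semicontinuous in vn m. *)
Let form_cvg_Q vn v : form_cvg a (form_restrict (ranJ a) Q) vn v ->
  forall e : R, 0 < e -> \forall n \near \oo, (Q (vn n \- v)%R <= e%:E)%E.
Proof.
move=> [dn sv cauchy] e e0; have [N HN] := cauchy _ e0.
near=> n; have Nn : (N <= n)%N by near: n; exact: nbhs_infty_ge.
apply: (@Q_lower_semicontinuous _ (fun m => vn n \- vn m) _ _ _ _).1.
  move=> k k0; apply: cvgB; first exact: cvg_cst.
  exact: strong_cvg_pointwise sv k0.
move=> M; exists (maxn M N); first exact: leq_maxl.
have h := HN n (maxn M N) Nn (leq_maxr _ _).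
have rnm := restrict_lty h; split; last exact: ranJ_cvg0.
by move: h; rewrite restrictE// => /ltW.
Unshelve. all: by end_near. Qed.

Let form_cvg_regular vn v : form_cvg a (form_restrict (ranJ a) Q) vn v -> regular v.
Proof.
move=> [dn sv cauchy]; have [_ l2v _] := sv.
have rn n : ranJ a (vn n) by exact: restrict_lty (dn n).
have [N HN] := cauchy _ ltr01.
pose B := fine (Q (vn N)).
have QB : (Q (vn N) <= B%:E)%E by rewrite /B fineK// (ranJ_Q_fin (rn N)).
apply/limit_formP; apply: (@le_lt_trans _ _ ((1 + 1) * B + (1 + 1^-1) * 1)%:E); last exact: ltry.
apply: (@limit_form_le vn) => //; first by move=> k k0; exact: strong_cvg_pointwise sv k0.
move=> M; exists (maxn M N); first exact: leq_maxl.
split => //; apply: (Q_perturb ltr01 QB).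
have h := HN (maxn M N) N (leq_maxr _ _) (leqnn _).
by move: (h); rewrite (restrictE (restrict_lty h)) => /ltW.
Qed.

Let form_cvg_limit vn v : form_cvg a (form_restrict (ranJ a) Q) vn v ->
  Q (vn n) @[n --> \oo] --> Q v.
Proof.
move=> fc; have [l2v Qv v0] := form_cvg_regular fc; have [dn sv _] := fc.
have rn n : ranJ a (vn n) by exact: restrict_lty (dn n).
have Qn n : (fine (Q (vn n)))%:E = Q (vn n) by rewrite fineK// (ranJ_Q_fin (rn n)).
pose B := fine (Q v); have QB : B%:E = Q v by exact: Q_fineK.
have B0 : 0 <= B by apply: fine_ge0; exact: Q_ge0.
rewrite -QB; under eq_fun do rewrite -Qn.
apply/cvg_EFin; first exact: nearW.
apply/cvgrPdist_le => e e0.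
pose h := e / (2 * (B + 1)).
have h0 : 0 < h by rewrite divr_gt0// mulr_gt0// ltr_wpDl.
have hB : h * B <= e / 2.
  rewrite /h mulrAC ler_pdivrMr ?mulr_gt0 ?ltr_wpDl//.
  by rewrite (_ : e / 2 * (2 * (B + 1)) = e * (B + 1)); [rewrite ler_pM2l//; lra|field].
pose d := e / 2 / (1 + h^-1).
have h1 : 0 < 1 + h^-1 by rewrite addr_gt0// invr_gt0.
have d0 : 0 < d by rewrite !divr_gt0.
have lower : \forall n \near \oo, B - e <= fine (Q (vn n)).
  apply: contrapT => nl.
  have fr N : exists2 n, (N <= n)%N & fine (Q (vn n)) < B - e.
    apply: contrapT => nex; apply: nl; exists N => // n /= Nn.
    by rewrite leNgt; apply/negP => lt; apply: nex; exists n.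
  have [] := @Q_lower_semicontinuous _ vn v (B - e).
  - by move=> k k0; exact: strong_cvg_pointwise sv k0.
  - move=> N; have [n Nn nB] := fr N; exists n => //; split; last exact: ranJ_cvg0.
    by rewrite -Qn lee_fin ltW.
  - by rewrite -QB lee_fin => + _; rewrite lerBrDr gerDl leNgt e0.
have upper : \forall n \near \oo, fine (Q (vn n)) <= B + e.
  have := form_cvg_Q fc d0; apply: filterS => n hn.
  rewrite -lee_fin Qn; apply: le_trans (Q_perturb h0 (_ : (Q v <= B%:E)%E) hn) _.
    by rewrite QB.
  rewrite lee_fin /d mulrCA divff ?gt_eqF// mulr1.
  by move: hB; lra.
near=> n; have l1 : B - e <= fine (Q (vn n)) by near: n.
have u1 : fine (Q (vn n)) <= B + e by near: n.
by rewrite /= ler_norml; apply/andP; split; move: l1 u1; lra.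
Unshelve. all: by end_near. Qed.

(** The approximants of a sequence in the domain are traces; conversely the domain and Q
    are stable under form convergence. *)
Lemma limit_form_closure : is_closure a (form_restrict (ranJ a) Q) limit_form.
Proof.
split.
  apply/seteqP; split => v; last by move=> [vn fc]; exact/limit_formP/(form_cvg_regular fc).
  move=> /limit_formP[l2v Qv v0].
  have rj j : ranJ a (approx v j) by exact: approx_ranJ.
  exists (approx v); split.
  - by move=> n; rewrite /form_dom/= restrictE// ltey_eq (ranJ_Q_fin (rj n)).
  - exact: approx_strong_cvg.
  - move=> e e0; have e8 : 0 < e / 8 by rewrite divr_gt0.
    have /(ecvg0P (fun n => Q_ge0 _))/(_ _ e8)[N _ HN] := approx_Q_cvg Qv.
    exists N => n m Nn Nm; rewrite restrictE; last exact: ranJ_sub.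
    have -> : approx v n \- approx v m = (approx v n \- v) \- (approx v m \- v).
      by apply/funext => k /=; ring.
    apply: le_lt_trans (Q_sub_le (HN _ Nn) (HN _ Nm)) _.
    by rewrite lte_fin; move: e0; lra.
move=> vn v fc; have rv := form_cvg_regular fc; rewrite limit_formE//.
have [dn _ _] := fc; under eq_fun do rewrite (restrictE (restrict_lty (dn _))).
exact: form_cvg_limit fc.
Qed.

(** Finite energy forces small oscillation near infinity. If v did not tend to 0, it would
    be bounded away from 0 there, and square summability would bound the total mass. *)
Lemma infinite_measure_cvg0 v : mu a [set k : nat | (0 < k)%N] = +oo%E ->
  l2 a v -> (Q v < +oo)%E -> v @ \oo --> (0 : R).
Proof.
move=> muoo l2v Qv.
pose B := fine (Q v); have /Q_leP QB : (Q v <= B%:E)%E by rewrite Q_fineK.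
pose L := fine (l2_norm2 a v).
have /(l2_leP a_gt0) lL : (l2_norm2 a v <= L%:E)%E by rewrite l2_fineK.
have a_ge0 k : (0 < k)%N -> 0 <= a k by move=> /a_gt0/ltW.
apply/cvgrPdist_lt => e e0; apply: contrapT => nv.
have fr N : exists2 m, (N <= m)%N & e <= `|v m|.
  apply: contrapT => nex; apply: nv; exists N => // m /= Nm.
  by rewrite sub0r normrN ltNge; apply/negP => le; apply: nex; exists m.
have e20 : 0 < e ^+ 2 / 4 by rewrite divr_gt0// exprn_gt0.
have [m mN vm] := fr (Num.bound (B / (e ^+ 2 / 4))).+1.
have m0 : (0 < m)%N by apply: leq_trans mN.
have B0 : 0 <= B by apply: fine_ge0; exact: Q_ge0.
have mB : B / m%:R <= e ^+ 2 / 4.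
  rewrite ler_pdivrMr ?ltr0n// mulrC -ler_pdivrMr//; apply/ltW.
  apply: lt_trans (archi_boundP _) _; first by rewrite divr_ge0// ltW.
  by rewrite ltr_nat.
have vn_ge n : (m <= n)%N -> e ^+ 2 / 4 <= v n ^+ 2.
  move=> mn; have osc : (v n - v m) ^+ 2 <= (e / 2) ^+ 2.
    apply: le_trans (Q_oscillation v m0 mn) _.
    rewrite (_ : (e / 2) ^+ 2 = e ^+ 2 / 4); last by field.
    apply: le_trans mB; rewrite mulrC; apply: ler_pM.
    - by apply: sumr_ge0 => k _; exact: q_term_ge0.
    - by rewrite subr_ge0 lef_pV2 ?posrE ?ler_nat ?ltr0n// (leq_trans m0).
    - apply: le_trans (QB n); rewrite [leRHS](big_cat_nat (n := m))//= lerDr.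
      by apply: sumr_ge0 => j _; exact: q_term_ge0.
    - by rewrite gerBl.
  have e2 : 0 <= e / 2 by rewrite divr_ge0// ltW.
  have osc' : `|v n - v m| <= e / 2.
    by rewrite -(@ler_pXn2r _ 2)// ?nnegrE// sqr_normr.
  have half : e / 2 <= `|v n|.
    have := ler_normD (v m - v n) (v n); rewrite subrK distrC.
    by move: vm osc'; lra.
  rewrite -(sqr_normr (v n)) (_ : e ^+ 2 / 4 = (e / 2) ^+ 2); last by field.
  by rewrite ler_pXn2r ?nnegrE.
have sum_le n : \sum_(1 <= k < n) a k <= \sum_(1 <= k < m) a k + L / (e ^+ 2 / 4).
  have L0 : 0 <= L by apply: fine_ge0; exact: l2_norm2_ge0.
  have [nm|mn] := leqP n m.
    by apply: (le_trans (sum1_mono a_ge0 nm)); rewrite lerDl divr_ge0// ltW.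
  rewrite (big_cat_nat (n := m))//=; last exact: ltnW.
  rewrite lerD2l ler_pdivlMr// mulr_suml.
  apply: (@le_trans _ _ (\sum_(m <= k < n) l2_term a v k)).
    rewrite big_nat [leRHS]big_nat; apply: ler_sum => k /andP[mk _].
    by rewrite ler_wpM2l ?vn_ge// a_ge0// (leq_trans m0).
  apply: le_trans (lL n); rewrite [leRHS](big_cat_nat (n := m))//=; last exact: ltnW.
  rewrite lerDr big_nat; apply: sumr_ge0 => k /andP[k0 _].
  by rewrite mulr_ge0 ?sqr_ge0 ?a_ge0.
have /(series_leP _ a_ge0) : forall n, \sum_(1 <= k < n) a k <=
  \sum_(1 <= k < m) a k + L / (e ^+ 2 / 4) by [].
rewrite (_ : (\sum_(1 <= k <oo) (a k)%:E)%E = mu a [set k : nat | (0 < k)%N]).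
  by rewrite muoo leye_eq.
apply: congr_lim; apply/funext => n; rewrite big_nat [RHS]big_nat.
by apply: eq_bigr => k /andP[k0 _]; rewrite diracE mem_set// mule1.
Qed.

End LimitForm.

Theorem theorem3p5 (R : realType) (a : nat -> R)
    (a_gt0 : forall k : nat, (0 < k)%N -> 0 < a k) :
  is_closure a (form_restrict (ranJ a) Q) (trace_form a) /\
  (mu a [set k : nat | (0 < k)%N] = +oo%E ->
     form_dom (trace_form a) = [set v : nat -> R | l2 a v /\ (Q v < +oo)%E] /\
     forall v : nat -> R, form_dom (trace_form a) v -> trace_form a v = Q v).
Proof.
rewrite trace_formE//; split; first exact: limit_form_closure.
move=> muoo; split.
  apply/seteqP; split => v; first by move=> /limit_formP[].
  move=> [l2v Qv]; apply/limit_formP; split => //.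
  exact: infinite_measure_cvg0 l2v Qv.
by move=> v /limit_formP rv; rewrite /limit_form asboolT.
Qed.
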